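(* Let $x=e^{-w}$, $t=1+\sum_{\mu\ge1}\frac{\mu^\mu}{\mu!}x^\mu$, and for $m\ge0$ let $$S_m^H(t)=\sum_{2g-2+n=m-1}\frac{1}{n!}F^H_{g,n}(t,\dots,t).$$ Then for every $m\ge0$, $$\Big(e^{mw}\frac{d}{dw}e^{-mw}\Big)S^H_{m+1}=-\frac12\Big[\frac{d^2}{dw^2}S^H_m+\sum_{a+b=m+1}\frac{dS^H_a}{dw}\cdot\frac{dS^H_b}{dw}+\frac{d}{dw}S^H_m\Big],$$ where $a,b\ge0$ in the sum. Moreover, $S_m^H(t)$ is a polynomial in $t$ of degree $3m-3$ for every $m\ge2$, and $S_m^H(1)=0$ for all $m\ge0$.
   Context: For $g\ge0$, $n\ge1$, $\mu\in\mathbb{Z}_{>0}^n$, $d=|\mu|$, $r=2g-2+n+d$: $h_{g,\mu}$ is $\frac1{d!}$ times the number of $r$-tuples of transpositions in $S_d$ generating a transitive subgroup whose product has cycle type $\mu$, and $H_{g,n}(\mu)=\frac{|\mathrm{Aut}(\mu)|}{r!}h_{g,\mu}$ (single Hurwitz numbers with labeled poles). $F^H_{g,n}(t_1,\dots,t_n)=\sum_{\mu\in\mathbb{Z}_{>0}^n}H_{g,n}(\mu)\prod_i x_i^{\mu_i}$, regarded as a function of $t_i$ via $x_i=z_ie^{-z_i}$, $z_i=(t_i-1)/t_i$; in particular $F^H_{g,n}(t,\dots,t)=\sum_\mu H_{g,n}(\mu)x^{|\mu|}$. The $w$-derivative acts through $t=t(w)$, with $-\frac{d}{dw}=x\frac{d}{dx}=t^2(t-1)\frac{d}{dt}$.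 *)

(* Defs.v *)
From mathcomp Require Import all_boot all_order all_fingroup all_algebra.
Set Implicit Arguments. Unset Strict Implicit. Unset Printing Implicit Defensive.
Import Order.TTheory GRing.Theory Num.Theory.
Local Open Scope ring_scope.

Definition is_transp (d : nat) (s : 'S_d) : bool :=
  [exists x : 'I_d, exists y : 'I_d, (x != y) && (s == tperm x y)].

Definition cycle_lengths (d : nat) (s : 'S_d) : seq nat :=
  [seq #|X| | X : {set 'I_d} <- enum (porbits s)].

Definition has_cycle_type (d n : nat) (s : 'S_d) (mu : 'I_n -> nat) : bool :=
  perm_eq (cycle_lengths s) [seq mu i | i <- enum 'I_n].

Definition hurwitz_count (d r n : nat) (mu : 'I_n -> nat) : nat :=
  #|[set s : {ffun 'I_r -> 'S_d} |
      [&& [forall i, is_transp (s i)],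
          [transitive <<[set s i | i : 'I_r]>>, on [set: 'I_d] | 'P]
        & has_cycle_type (\prod_(i < r) s i)%g mu]]|.

Definition msize (n : nat) (mu : 'I_n -> nat) : nat := (\sum_(i < n) mu i)%N.

(* r = 2g - 2 + n + d  (n + d >= 2 whenever n >= 1, so no truncation) *)
Definition nb_branch (g n d : nat) : nat := (2 * g + n + d - 2)%N.

Definition h_hur (g n : nat) (mu : 'I_n -> nat) : rat :=
  let d := msize mu in
  (hurwitz_count d (nb_branch g n d) mu)%:R / (d`!)%:R.

Definition aut_card (n : nat) (mu : 'I_n -> nat) : nat :=
  #|[set sg : 'S_n | [forall i, mu (sg i) == mu i]]|.

Definition H_hur (g n : nat) (mu : 'I_n -> nat) : rat :=
  let r := nb_branch g n (msize mu) in
  (aut_card mu)%:R / (r`!)%:R * h_hur g mu.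

Definition fps := nat -> rat.

Definition fps_mul (f g : fps) : fps :=
  fun k => \sum_(i < k.+1) f i * g (k - i)%N.

Definition fps_one : fps := fun k => (k == 0%N)%:R.

Fixpoint fps_pow (f : fps) (i : nat) : fps :=
  if i is i'.+1 then fps_mul f (fps_pow f i') else fps_one.

(* d/dw = - x d/dx  (x = e^{-w}) *)
Definition fps_Dw (f : fps) : fps := fun k => - (k%:R * f k).

Definition fps_xpow (m : nat) (f : fps) : fps :=
  fun k => if (m <= k)%N then f (k - m)%N else 0.

(* multiplication by x^{-m} = e^{mw} (applied to series divisible by x^m) *)
Definition fps_xinv (m : nat) (f : fps) : fps := fun k => f (k + m)%N.

Definition fps_of_poly (p : {poly rat}) (f : fps) : fps :=
  fun k => \sum_(i < size p) p`_i * fps_pow f i k.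

Definition t_fps : fps :=
  fun k => if k is 0%N then 1 else (k ^ k)%:R / (k`!)%:R.

(* coefficient of x^k in F^H_{g,n}(t,...,t) = sum_{mu in Z_{>0}^n, |mu| = k} H_{g,n}(mu) *)
Definition F_diag_coef (g n k : nat) : rat :=
  \sum_(mu : {ffun 'I_n -> 'I_k.+1} |
          [forall i, (0 < mu i)%N] && (\sum_(i < n) (mu i : nat) == k)%N)
     H_hur g (fun i => (mu i : nat)).

(* S^H_m = sum over g >= 0, n >= 1 with 2g - 2 + n = m - 1 of F^H_{g,n}(t,..,t)/n!;
   i.e. n = m + 1 - 2g with 2g <= m *)
Definition S_H (m : nat) : fps :=
  fun k => \sum_(g < m.+1 | (2 * g <= m)%N)
             ((m.+1 - 2 * g)`!)%:R^-1 * F_diag_coef g (m.+1 - 2 * g) k.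

(* Main.v *)
From HB Require Import structures.
Require Import Defs.
From mathcomp Require Import all_boot all_order all_fingroup all_algebra.
From mathcomp Require Import zify ring boolp.
Set Implicit Arguments. Unset Strict Implicit. Unset Printing Implicit Defensive.
Import Order.TTheory GRing.Theory Num.Theory.

(** For k >= 1, [S_H m] has k-th coefficient N(k, k+m-1) / (k! (k+m-1)!), where
    N(k, r) counts all transitive r-tuples of transpositions in S_k: summing over
    mu forgets the cycle type of the product, and Riemann-Hurwitz together with
    parity says that the number of cycles is m+1-2g for some g >= 0.  A transitive
    tuple is a connected multigraph with r labelled edges on k labelled vertices,
    and deleting one edge leaves either a connected graph or two connected
    components, which is the differential recursion.

    Connectedness forces r >= k - 1, and for r = k - 1 the recursion reads
    D S_0 - S_0 = (D S_0)^2 / 2, where D = x d/dx.  Hence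
    z := D S_0 is the tree function, t = 1 / (1 - z) and D t = t^2 (t - 1); then
    D S_1 = (t - 1)^2 / 2 and S_2 = (t - 1)^2 (5 t - 3) / 24.  For m >= 2 the
    recursion is the linear equation t (t - 1) p' + m p = R for p = S_(m+1).  By
    induction D S_a is divisible by t^a for 2 <= a <= m, hence R = t^(m+1) q, and
    p = t^m u reduces the equation to (t - 1) u' + m u = q, which has a unique
    polynomial solution, of the degree of q. *)

(** * Connected multigraphs *)

Section Multigraph.
Variables I T : finType.
Implicit Types (e : {ffun I -> T * T}) (A B C : {set T}) (R : {set I}).

Definition loopless e := [forall i, (e i).1 != (e i).2].

(** The closed sets are the unions of connected components. Testing connectivity on them avoids
    paths and matches the sets stable under a family of permutations. *)
Definition edge_closed e B := [forall i, ((e i).1 \in B) == ((e i).2 \in B)].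

Definition graph_connected e :=
  [forall B, edge_closed e B ==> (B == set0) || (B == setT)].

Definition connected_graphs := [set e | loopless e && graph_connected e].

(** An empty side is allowed here; the recursion weights [A] by [#|A| * #|~: A|], which discards
    it. *)
Definition two_components e A :=
  [&& edge_closed e A,
      [forall B : {set T}, edge_closed e B && (B \subset A) ==> (B == set0) || (B == A)] &
      [forall B : {set T}, edge_closed e B && (B \subset ~: A) ==> (B == set0) || (B == ~: A)]].

Lemma edge_closedP e B :
  reflect (forall i, ((e i).1 \in B) = ((e i).2 \in B)) (edge_closed e B).
Proof. by apply: (iffP forallP) => h i; apply/eqP; rewrite ?h //; apply: h. Qed.

Lemma edge_closedC e B : edge_closed e B -> edge_closed e (~: B).
Proof. by move=> /edge_closedP h; apply/edge_closedP => i; rewrite !inE h. Qed.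

Lemma edge_closedI e B C :
  edge_closed e B -> edge_closed e C -> edge_closed e (B :&: C).
Proof.
by move=> /edge_closedP h /edge_closedP k; apply/edge_closedP => i; rewrite !inE h k.
Qed.

Lemma two_componentsP e A :
  reflect [/\ edge_closed e A,
    forall B, edge_closed e B -> B \subset A -> B = set0 \/ B = A &
    forall B, edge_closed e B -> B \subset ~: A -> B = set0 \/ B = ~: A]
    (two_components e A).
Proof.
apply: (iffP and3P) => [[h1 /forallP h2 /forallP h3]|[h1 h2 h3]].
  split=> // B cB sB.
    by have := h2 B; rewrite cB sB /= => /orP[/eqP|/eqP]; [left|right].
  by have := h3 B; rewrite cB sB /= => /orP[/eqP|/eqP]; [left|right].
split=> //; apply/forallP => B; apply/implyP => /andP[cB sB]; apply/orP.
  by case: (h2 B cB sB) => ->; [left|right]; rewrite eqxx.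
by case: (h3 B cB sB) => ->; [left|right]; rewrite eqxx.
Qed.

Lemma graph_connectedP e :
  reflect (forall B, edge_closed e B -> B = set0 \/ B = setT) (graph_connected e).
Proof.
apply: (iffP forallP) => h B.
  by move=> cB; have := h B; rewrite cB /= => /orP[/eqP|/eqP]; [left|right].
by apply/implyP => cB; apply/orP; case: (h B cB) => ->; [left|right]; rewrite eqxx.
Qed.

(** The quantified sets are the closed sets of [e] enlarged by the edge [p], so this is
    connectedness of the enlarged graph. *)
Definition joins e (p : T * T) :=
  [forall B, edge_closed e B && ((p.1 \in B) == (p.2 \in B)) ==> (B == set0) || (B == setT)].

Lemma joinsP e p :
  reflect (forall B, edge_closed e B -> (p.1 \in B) = (p.2 \in B) -> B = set0 \/ B = setT)
    (joins e p).
Proof.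
apply: (iffP forallP) => h B.
  by move=> cB /eqP eB; have := h B; rewrite cB eB /= => /orP[/eqP|/eqP]; [left|right].
apply/implyP => /andP[cB /eqP eB].
by apply/orP; case: (h B cB eB) => ->; [left|right]; rewrite eqxx.
Qed.

Lemma two_components_joins e A p :
  two_components e A -> p.1 \in A -> p.2 \notin A -> joins e p && ~~ graph_connected e.
Proof.
case: p => x y /= /two_componentsP[cA hA hA'] xA yA; apply/andP; split.
  apply/joinsP => B cB /= xy.
  have h1 := hA _ (edge_closedI cB cA) (subsetIr _ _).
  have h2 := hA' _ (edge_closedI cB (edge_closedC cA)) (subsetIr _ _).
  have BE : B = (B :&: A) :|: (B :&: ~: A) by rewrite -setIUr setUCr setIT.
  have xB : (x \in B :&: A) = (y \in B :&: ~: A) by rewrite !inE xA yA !andbT.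
  case: h1 h2 => [e1|e1] [e2|e2]; rewrite e1 e2 in BE xB.
  - by left; rewrite BE setU0.
  - by rewrite !inE yA in xB.
  - by rewrite !inE xA in xB.
  - by right; rewrite BE setUCr.
apply/negP => /graph_connectedP /(_ A cA) [E|E].
  by rewrite E inE in xA.
by rewrite E inE in yA.
Qed.

(** A closed set that witnesses disconnectedness must separate the ends of [p], since otherwise it
    would survive the addition of [p]. Within either side, a closed subset or its remainder misses
    both ends of [p], hence is empty. *)
Lemma joins_two_components e p :
  joins e p -> ~~ graph_connected e ->
  exists A, [&& two_components e A, p.1 \in A & p.2 \notin A].
Proof.
case: p => x y /joinsP /= J nc.
have [B cB [xB yB]] : exists2 B, edge_closed e B & x \in B /\ y \notin B.
  move: nc; rewrite negb_forall => /existsP[B].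
  rewrite negb_imply negb_or => /and3P[cB B0 BT].
  have [xB|xB] := boolP (x \in B).
    exists B => //; split=> //; apply/negP => yB.
    have [E|E] : B = set0 \/ B = setT by apply: J => //; rewrite xB yB.
      by rewrite E eqxx in B0.
    by rewrite E eqxx in BT.
  exists (~: B); first exact: edge_closedC.
  rewrite !inE xB negbK; split=> //; apply: contraT => yB.
  have [E|E] : B = set0 \/ B = setT.
  - by apply: J => //; rewrite (negbTE xB) (negbTE yB).
  - by rewrite E eqxx in B0.
  - by rewrite E eqxx in BT.
exists B; rewrite xB yB !andbT; apply/two_componentsP; split=> // C cC sC.
  have yC : y \notin C by apply: contra yB; apply: (subsetP sC).
  have [xC|xC] := boolP (x \in C); last first.
    left; case: (J C cC) => [||E] //; first by rewrite (negbTE xC) (negbTE yC).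
    by rewrite E inE in yC.
  right; apply/eqP; rewrite eqEsubset sC /=.
  case: (J _ (edge_closedI cB (edge_closedC cC))) => [|E|E].
  - by rewrite !inE xC (negbTE yB) andbF.
  - by rewrite -setDE in E; rewrite -setD_eq0 E.
  - by move/setP: E => /(_ y); rewrite !inE (negbTE yB).
have xC : x \notin C by apply/negP => /(subsetP sC); rewrite inE xB.
have [yC|yC] := boolP (y \in C); last first.
  left; case: (J C cC) => [||E] //; first by rewrite (negbTE xC) (negbTE yC).
  by rewrite E inE in yC.
right; apply/eqP; rewrite eqEsubset sC /=.
case: (J _ (edge_closedI (edge_closedC cB) (edge_closedC cC))) => [|E|E].
- by rewrite !inE xB yC andbF.
- by rewrite -setDE in E; rewrite -setD_eq0 E.
- by move/setP: E => /(_ x); rewrite !inE xB.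
Qed.

Lemma two_components_inj e A B x :
  two_components e A -> two_components e B -> x \in A -> x \in B -> A = B.
Proof.
move=> /two_componentsP[cA hA _] /two_componentsP[cB hB _] xA xB.
have x0 : x \in A :&: B by rewrite inE xA.
case: (hA _ (edge_closedI cA cB) (subsetIl _ _)) => [E|{1}<-]; first by rewrite E inE in x0.
by case: (hB _ (edge_closedI cA cB) (subsetIr _ _)) => [E|//]; rewrite E inE in x0.
Qed.

(** At most one term is nonzero, that of the component of [p.1]; the order of the pair [p] decides
    which of the two components is counted. *)
Lemma joins_count e p :
  (joins e p && ~~ graph_connected e : nat) =
  \sum_(A : {set T}) [&& two_components e A, p.1 \in A & p.2 \notin A].
Proof.
have [/andP[J nc]|nJ] := boolP (joins e p && _).
  have [A /and3P[tA xA yA]] := joins_two_components J nc.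
  rewrite (bigD1 A) //= tA xA yA big1 // => B nAB.
  apply/eqP; rewrite eqb0; apply: contra nAB => /and3P[tB xB yB].
  by rewrite (two_components_inj tB tA xB xA).
rewrite big1 // => A _; apply/eqP; rewrite eqb0; apply: contra nJ.
by move=> /and3P[]; apply: two_components_joins.
Qed.

Lemma connected_joins e p : graph_connected e -> joins e p.
Proof. by move=> /graph_connectedP h; apply/joinsP => B cB _; apply: h. Qed.

End Multigraph.

(** * Invariance under relabelling of edges and vertices *)

Section Relabel.
Variables (I J T U : finType) (f : I -> J) (f' : J -> I) (g : T -> U) (g' : U -> T).
Hypotheses (fK : cancel f f') (f'K : cancel f' f) (gK : cancel g g') (g'K : cancel g' g).

Definition relabel (e : {ffun I -> T * T}) : {ffun J -> U * U} :=
  [ffun j => (g (e (f' j)).1, g (e (f' j)).2)].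

Lemma relabel_connected e : e \in connected_graphs I T -> relabel e \in connected_graphs J U.
Proof.
rewrite !inE => /andP[/forallP ll /graph_connectedP h]; apply/andP; split.
  by apply/forallP => j; rewrite ffunE /= (can_eq gK).
apply/graph_connectedP => B /edge_closedP cB.
have inB x : (x \in g @^-1: B) = (g x \in B) by rewrite inE.
case: (h (g @^-1: B)) => [|E|E].
- by apply/edge_closedP => i; have := cB (f i); rewrite ffunE /= fK !inB.
- by left; apply/setP => u; rewrite -(g'K u) -inB E !inE.
- by right; apply/setP => u; rewrite -(g'K u) -inB E !inE.
Qed.

End Relabel.

Lemma relabelK (I J T U : finType) (f : I -> J) (f' : J -> I) (g : T -> U) (g' : U -> T) :
  cancel f f' -> cancel g g' -> cancel (relabel f' g) (relabel f g').
Proof.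
move=> fK gK e; apply/ffunP => i; rewrite !ffunE /= fK !gK.
by case: (e i).
Qed.

Definition nb_connected (r k : nat) := #|connected_graphs 'I_r 'I_k|.

Lemma card_connected_graphs (I T : finType) :
  #|connected_graphs I T| = nb_connected #|I| #|T|.
Proof.
pose h := relabel (@enum_val I I) (@enum_rank T).
pose h' := relabel (@enum_rank I) (@enum_val T T).
have hK : cancel h h' by apply: relabelK; [exact: enum_rankK|exact: enum_rankK].
have h'K : cancel h' h by apply: relabelK; [exact: enum_valK|exact: enum_valK].
rewrite -(card_imset _ (can_inj hK)); apply: eq_card => e.
apply/imsetP/idP => [[e' ce' ->]|ce].
  by apply: (relabel_connected (f := @enum_rank I) (g' := @enum_val T T));
   [exact: enum_rankK|exact: enum_rankK|exact: enum_valK|].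
exists (h' e); rewrite ?h'K //.
by apply: (relabel_connected (f := @enum_val I I) (g' := @enum_rank T));
   [exact: enum_valK|exact: enum_valK|exact: enum_rankK|].
Qed.

(** * Disjoint unions of two connected graphs *)

Section Glue.
Variables (I T : finType) (R : {set I}) (A : {set T}).
Let I1 := {i | i \in R}.
Let I2 := {i | i \in ~: R}.
Let T1 := {x | x \in A}.
Let T2 := {x | x \in ~: A}.

Definition glue (e : {ffun I1 -> T1 * T1} * {ffun I2 -> T2 * T2}) : {ffun I -> T * T} :=
  [ffun i => match boolP (i \in R) with
    | AltTrue h => let p := e.1 (exist _ i h) in (val p.1, val p.2)
    | AltFalse h => let p := e.2 (exist _ i (etrans (in_setC i R) h)) in (val p.1, val p.2)
    end].

Lemma glue1 e (i : I1) : glue e (val i) = (val (e.1 i).1, val (e.1 i).2).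
Proof.
rewrite ffunE; case: {-}_ / boolP => h; last by case/negP: h; exact: valP i.
by have -> : exist _ (val i) h = i by apply: val_inj.
Qed.

Lemma glue2 e (i : I2) : glue e (val i) = (val (e.2 i).1, val (e.2 i).2).
Proof.
rewrite ffunE; case: {-}_ / boolP => h; first by have := valP i; rewrite inE /= h.
by have -> : exist _ (val i) (etrans (in_setC (val i) R) h) = i :> I2 by apply: val_inj.
Qed.

Lemma glue_cases (P : I -> Prop) :
  (forall i : I1, P (val i)) -> (forall i : I2, P (val i)) -> forall i, P i.
Proof.
move=> h1 h2 i; have [h|h] := boolP (i \in R); first exact: (h1 (exist _ i h)).
exact: (h2 (exist _ i (etrans (in_setC i R) h))).
Qed.

Lemma glue_inj : injective glue.
Proof.
move=> [e1 e2] [d1 d2] E; congr pair; apply/ffunP => i.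
  have := congr1 (fun e : {ffun I -> T * T} => e (val i)) E.
  by rewrite !glue1 /=; case: (e1 i) (d1 i) => [a b] [c d] [] /val_inj -> /val_inj ->.
have := congr1 (fun e : {ffun I -> T * T} => e (val i)) E.
by rewrite !glue2 /=; case: (e2 i) (d2 i) => [a b] [c d] [] /val_inj -> /val_inj ->.
Qed.

(** Since [A] is closed, the first end of an edge decides its side, so [R] is the set of edges
    inside [A]. *)
Definition split_graphs := [set e : {ffun I -> T * T} |
  [&& loopless e, two_components e A & [set i | (e i).1 \in A] == R]].

Lemma glue_split e : e.1 \in connected_graphs I1 T1 -> e.2 \in connected_graphs I2 T2 ->
  glue e \in split_graphs.
Proof.
rewrite !inE => /andP[/forallP l1 /graph_connectedP h1] /andP[/forallP l2 /graph_connectedP h2].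
have A2 (x : T2) : val x \in A = false by have := valP x; rewrite inE => /negbTE.
have A1 (x : T1) : val x \in A by apply: (valP x).
apply/and3P; split.
- by apply/forallP; apply: glue_cases => i; rewrite ?glue1 ?glue2 /= (inj_eq val_inj).
- apply/two_componentsP; split.
  + apply/edge_closedP; apply: glue_cases => i; rewrite ?glue1 ?glue2 /=; first by rewrite !A1.
    by rewrite !A2.
  + move=> B /edge_closedP cB sB.
    have inB x : (x \in [set x : T1 | val x \in B]) = (val x \in B) by rewrite inE.
    case: (h1 [set x : T1 | val x \in B]) => [|E|E].
    * by apply/edge_closedP => i; have := cB (val i); rewrite glue1 /= !inE.
    * left; apply/setP => x; rewrite inE; apply/negP => xB.
      by have := inB (exist _ x (subsetP sB x xB)); rewrite E inE /= xB.
    * right; apply/eqP; rewrite eqEsubset sB; apply/subsetP => x xA.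
      by have := inB (exist _ x xA); rewrite E inE /= => <-.
  + move=> B /edge_closedP cB sB.
    have inB x : (x \in [set x : T2 | val x \in B]) = (val x \in B) by rewrite inE.
    case: (h2 [set x : T2 | val x \in B]) => [|E|E].
    * by apply/edge_closedP => i; have := cB (val i); rewrite glue2 /= !inE.
    * left; apply/setP => x; rewrite inE; apply/negP => xB.
      by have := inB (exist _ x (subsetP sB x xB)); rewrite E inE /= xB.
    * right; apply/eqP; rewrite eqEsubset sB; apply/subsetP => x xA.
      by have := inB (exist _ x xA); rewrite E inE /= => <-.
- apply/eqP/setP; apply: glue_cases => i; rewrite inE ?glue1 ?glue2 /=.
    by rewrite A1 (valP i).
  by rewrite A2; have := valP i; rewrite inE => /negbTE ->.
Qed.

(** Closedness of [A] keeps both ends of an edge on one side, so [d] restricts to both parts. A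
    closed set of one part is closed in [d], because the edges of the other part do not meet it. *)
Lemma split_glue d : d \in split_graphs -> exists2 e,
  e.1 \in connected_graphs I1 T1 /\ e.2 \in connected_graphs I2 T2 & d = glue e.
Proof.
rewrite inE => /and3P[/forallP ll /two_componentsP[/edge_closedP cA hA hA'] /eqP RE].
have RE' i : (i \in R) = ((d i).1 \in A) by rewrite -RE inE.
have /fin_all_exists[e1 e1E] : forall i : I1, exists p : T1 * T1, d (val i) = (val p.1, val p.2).
  move=> i; have h1 : (d (val i)).1 \in A by rewrite -RE'; apply: valP.
  have h2 : (d (val i)).2 \in A by rewrite -cA.
  by exists (exist _ (d (val i)).1 h1 : T1, exist _ (d (val i)).2 h2 : T1); exact: surjective_pairing.
have /fin_all_exists[e2 e2E] : forall i : I2, exists p : T2 * T2, d (val i) = (val p.1, val p.2).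
  move=> i; have h1 : (d (val i)).1 \in ~: A by rewrite inE -RE'; have := valP i; rewrite inE.
  have h2 : (d (val i)).2 \in ~: A by rewrite inE -cA -in_setC.
  by exists (exist _ (d (val i)).1 h1 : T2, exist _ (d (val i)).2 h2 : T2); exact: surjective_pairing.
exists ([ffun i => e1 i], [ffun i => e2 i]); last first.
  by apply/ffunP; apply: glue_cases => i; [rewrite glue1 e1E | rewrite glue2 e2E] => /=; rewrite ffunE.
have v1 (B : {set T1}) x : (val x \in val @: B) = (x \in B) by apply: mem_imset; apply: val_inj.
have v2 (B : {set T2}) x : (val x \in val @: B) = (x \in B) by apply: mem_imset; apply: val_inj.
split; rewrite inE; apply/andP; split.
- by apply/forallP => i; have := ll (val i); rewrite /= ffunE e1E (inj_eq val_inj).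
- apply/graph_connectedP => B /edge_closedP cB.
  have sB : [set val x | x in B] \subset A by apply/subsetP => _ /imsetP[x _ ->]; apply: valP.
  case: (hA [set val x | x in B]) => // [|E|E].
  + apply/edge_closedP; apply: glue_cases => i.
      by rewrite e1E /= !v1; have := cB i; rewrite ffunE.
    have h (x : T2) : val x \in [set val x | x in B] = false.
      by apply/negP => /(subsetP sB); have := valP x; rewrite inE => /negbTE ->.
    by rewrite e2E /= !h.
  + by left; apply/setP => x; rewrite -v1 E !inE.
  + by right; apply/setP => x; rewrite -v1 E !inE; apply: valP.
- by apply/forallP => i; have := ll (val i); rewrite /= ffunE e2E (inj_eq val_inj).
- apply/graph_connectedP => B /edge_closedP cB.
  have sB : [set val x | x in B] \subset ~: A by apply/subsetP => _ /imsetP[x _ ->]; apply: valP.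
  case: (hA' [set val x | x in B]) => // [|E|E].
  + apply/edge_closedP; apply: glue_cases => i.
      have h (x : T1) : val x \in [set val x | x in B] = false.
        by apply/negP => /(subsetP sB); rewrite inE (valP x).
      by rewrite e1E /= !h.
    by rewrite e2E /= !v2; have := cB i; rewrite ffunE.
  + by left; apply/setP => x; rewrite -v2 E !inE.
  + by right; apply/setP => x; rewrite -v2 E !inE; have := valP x; rewrite inE.
Qed.

Lemma card_split_graphs :
  #|split_graphs| = (nb_connected #|R| #|A| * nb_connected #|~: R| #|~: A|)%N.
Proof.
have -> : split_graphs = glue @: setX (connected_graphs I1 T1) (connected_graphs I2 T2).
  apply/setP => d; apply/idP/imsetP => [/split_glue[e [h1 h2] ->]|[e]].
    by exists e => //; rewrite inE h1 h2.
  by rewrite inE => /andP[h1 h2] ->; apply: glue_split.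
by rewrite (card_imset _ glue_inj) cardsX !card_connected_graphs !card_sig.
Qed.
End Glue.

(** * Counting by deletion of an edge *)

Lemma sum_by_card (T : finType) (F : nat -> nat -> nat) :
  (\sum_(A : {set T}) F #|A| #|~: A| = \sum_(i < #|T|.+1) 'C(#|T|, i) * F i (#|T| - i))%N.
Proof.
rewrite (partition_big (fun A : {set T} => inord #|A| : 'I_#|T|.+1) predT) //=.
apply: eq_bigr => i _.
have ltA (A : {set T}) : #|A| < #|T|.+1 by rewrite ltnS max_card.
rewrite (eq_bigr (fun=> F i (#|T| - i)%N)) => [|A /eqP <-]; last first.
  by rewrite inordK // [#|~: A|]cardsCs setCK.
rewrite sum_nat_const -card_draws; congr (_ * _)%N.
by apply: eq_card => A; rewrite [RHS]inE unfold_in /= inordK.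
Qed.

Definition add_edge r (T : finType) (q : {ffun 'I_r -> T * T} * (T * T)) : {ffun 'I_r.+1 -> T * T} :=
  [ffun i => if unlift ord0 i is Some j then q.1 j else q.2].

Lemma forall_ordS r (P : pred 'I_r.+1) :
  [forall i, P i] = P ord0 && [forall i : 'I_r, P (lift ord0 i)].
Proof.
apply/forallP/andP => [h|[h0 /forallP h] i]; first by split=> //; apply/forallP.
by case: (unliftP ord0 i) => [j ->|->].
Qed.

Lemma add_edge_connected r (T : finType) q :
  (@add_edge r T q \in connected_graphs _ _) =
  [&& q.2.1 != q.2.2, loopless q.1 & joins q.1 q.2].
Proof.
have q0 : add_edge q ord0 = q.2 by rewrite ffunE unlift_none.
have qS i : add_edge q (lift ord0 i) = q.1 i by rewrite ffunE liftK.
rewrite inE /loopless forall_ordS q0 -andbA; congr [&& _, _ & _].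
  by apply: eq_forallb => i; rewrite qS.
apply: eq_forallb => B; congr (_ ==> _).
rewrite /edge_closed forall_ordS q0 andbC; congr (_ && _).
by apply: eq_forallb => i; rewrite qS.
Qed.

Lemma card_offdiag (T : finType) :
  \sum_(p : T * T) (p.1 != p.2 : nat) = (#|T| * #|T|.-1)%N.
Proof.
rewrite -(pair_bigA _ (fun x y : T => (x != y : nat))) /= -sum_nat_const.
apply: eq_bigr => x _; rewrite -(cardC1 x) -sum1_card [RHS]big_mkcond /=.
by apply: eq_bigr => y _; rewrite !inE eq_sym; case: (y == x).
Qed.

Lemma sum_mem_cut (T : finType) (A : {set T}) :
  \sum_(p : T * T) ((p.1 \in A) && (p.2 \notin A) : nat) = (#|A| * #|~: A|)%N.
Proof.
rewrite -cardsX -sum1_card [RHS]big_mkcond /=.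
by apply: eq_bigr => -[x y] _; rewrite in_setX /= in_setC; case: (_ && _).
Qed.

(* Deleting the edge [0] of a connected graph leaves either a connected graph or
   exactly two components; [A] is the one containing the first end of that edge. *)
Lemma nb_connected_rec r k :
  nb_connected r.+1 k = (k * k.-1 * nb_connected r k +
    \sum_(i < k.+1) 'C(k, i) * (i * (k - i) *
      \sum_(j < r.+1) 'C(r, j) * (nb_connected j i * nb_connected (r - j) (k - i))))%N.
Proof.
pose T : finType := 'I_k.
have -> : nb_connected r.+1 k =
   \sum_(q : {ffun 'I_r -> T * T} * (T * T)) [&& q.2.1 != q.2.2, loopless q.1 & joins q.1 q.2].
  rewrite /nb_connected -sum1_card big_mkcond /=.
  rewrite (reindex (@add_edge r T)) /=.
    by apply: eq_bigr => q _; rewrite add_edge_connected; case: (_ && _).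
  exists (fun e => ([ffun i => e (lift ord0 i)], e ord0)) => [[e p]|e] _.
    congr pair; last by rewrite ffunE unlift_none.
    by apply/ffunP => i; rewrite !ffunE liftK.
  by apply/ffunP => i; rewrite ffunE; case: unliftP => [j ->|->] /=; rewrite ?ffunE.
rewrite -(pair_bigA _ (fun e (p : T * T) => [&& p.1 != p.2, loopless e & joins e p] : nat)) /=.
(* For a fixed [e], the admissible new edges are all off-diagonal pairs if [e] is connected, and the
   pairs crossing from one component to the other, which are never loops, if it has two. *)
have E (e : {ffun 'I_r -> T * T}) :
    \sum_(p : T * T) ([&& p.1 != p.2, loopless e & joins e p] : nat) =
    ((e \in connected_graphs _ _) * (k * k.-1) +
     \sum_(A : {set T}) (loopless e && two_components e A) * (#|A| * #|~: A|))%N.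
  have <- : \sum_(p : T * T) (p.1 != p.2 : nat) = (k * k.-1)%N by rewrite card_offdiag card_ord.
  under [X in (_ + X)%N]eq_bigr => A _ do rewrite -sum_mem_cut big_distrr /=.
  rewrite exchange_big /= big_distrr /= -big_split /=; apply: eq_bigr => p _.
  rewrite inE; case: (loopless e) => /=; last first.
    by rewrite andbF mul0n big1 // => A _; rewrite mul0n.
  under [X in (_ + X)%N]eq_bigr => A _ do rewrite mulnb.
  rewrite -joins_count; have [c|c] := boolP (graph_connected e).
    by rewrite connected_joins //= mul1n addn0 andbT.
  rewrite mul0n add0n andbT; case: (boolP (joins e p)) => [J|_]; last by rewrite andbF.
  have [A /and3P[_ xA yA]] := joins_two_components J c.
  by rewrite andbT; case: eqP => // E; rewrite -E xA in yA.
rewrite (eq_bigr _ (fun e _ => E e)) big_split /=; congr (_ + _)%N.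
  by rewrite -big_distrl /= mulnC; congr (_ * _)%N; rewrite /nb_connected -sum1_card [RHS]big_mkcond.
rewrite exchange_big /=.
rewrite -[in X in _ = X](card_ord k) -[X in _ = X]
  (sum_by_card T (fun a b => a * b *
    \sum_(j < r.+1) 'C(r, j) * (nb_connected j a * nb_connected (r - j) b)))%N.
apply: eq_bigr => A _; rewrite -big_distrl /= mulnC; congr (_ * _)%N.
have := sum_by_card 'I_r (fun c d => nb_connected c #|A| * nb_connected d #|~: A|)%N.
rewrite card_ord => <-.
under [RHS]eq_bigr => R _ do rewrite -card_split_graphs -sum1_card big_mkcond.
rewrite exchange_big /=; apply: eq_bigr => e _.
(* Given [e] and [A], only the set of edges inside [A] contributes to the sum over [R]. *)
rewrite (bigD1 [set i | (e i).1 \in A]) //= big1 => [|R nR]; last first.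
  by rewrite inE eq_sym (negbTE nR) !andbF.
by rewrite addn0 inE eqxx andbT; case: (_ && _).
Qed.

(** * Transitive tuples of transpositions *)

Lemma is_transpP d (s : 'S_d) :
  reflect (exists x y, x != y /\ s = tperm x y) (is_transp s).
Proof.
apply: (iffP existsP) => [[x /existsP[y /andP[xy /eqP ->]]]|[x [y [xy ->]]]].
  by exists x, y.
by exists x; apply/existsP; exists y; rewrite xy eqxx.
Qed.

Definition transitive_tuples r d := [set s : {ffun 'I_r -> 'S_d} |
  [forall i, is_transp (s i)] && [transitive <<[set s i | i : 'I_r]>>, on [set: 'I_d] | 'P]].

(** A stable set is a union of orbits; phrased this way, transitivity has the same form as
    [graph_connected]. *)
Lemma transitive_genP (I T : finType) (s : I -> {perm T}) : 0 < #|T| ->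
  reflect (forall B : {set T}, (forall i x, (s i x \in B) = (x \in B)) -> B = set0 \/ B = setT)
    [transitive <<[set s i | i : I]>>, on [set: T] | 'P].
Proof.
move=> T0; set G := <<_>>%g.
have inG i : s i \in G by apply/mem_gen/imset_f.
apply: (iffP idP) => [tr B cB|h].
  have sGN : G \subset 'N(B | 'P)%g.
    rewrite gen_subG; apply/subsetP => _ /imsetP[i _ ->]; apply/astabsP => x.
    exact: cB.
  have [->|[x xB]] := set_0Vmem B; first by left.
  right; apply/setP => y; rewrite inE.
  have : y \in orbit 'P G x by rewrite (atransP tr).
  move=> /orbitP[a aG <-].
  by rewrite (astabs_act _ (subsetP sGN a aG)).
have /card_gt0P[x0 _] := T0; apply/imsetP; exists x0; rewrite ?inE //.
have sO x i : x \in orbit 'P G x0 -> s i x \in orbit 'P G x0.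
  move=> /orbitP[a aG <-]; apply/orbitP; exists (a * s i)%g; first by rewrite groupM.
  by rewrite /= /aperm permM.
case: (h (orbit 'P G x0)) => [i x|E|->//]; last by have := orbit_refl 'P G x0; rewrite E inE.
apply/idP/idP; last exact: sO.
move=> /orbitP[a aG ax]; apply/orbitP; exists (a * (s i)^-1)%g; first by rewrite groupM ?groupV.
by move: ax; rewrite /= /aperm permM => ->; rewrite permK.
Qed.

Lemma edge_closed_tperm (T : finType) (x y : T) (B : {set T}) :
  (x \in B) = (y \in B) <-> forall u, (tperm x y u \in B) = (u \in B).
Proof.
split=> [E u|/(_ y)]; last by rewrite tpermR.
by case: tpermP => // ->.
Qed.

Lemma card_tperm_pairs d (s : 'S_d) : is_transp s ->
  #|[pred p : 'I_d * 'I_d | (p.1 != p.2) && (tperm p.1 p.2 == s)]| = 2.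
Proof.
move=> /is_transpP[x [y [xy ->]]].
(* The number 2 is rewritten as the cardinality of the set of the two pairs [(x, y)] and
   [(y, x)]. *)
rewrite -[2]/(true.+1) -[in RHS]xy.
have -> : (x != y).+1 = ((x, y) != (y, x)).+1.
  by rewrite xpair_eqE [y == x]eq_sym andbb.
rewrite -cards2; apply: eq_card => -[a b]; rewrite !inE /= !xpair_eqE.
apply/andP/orP => [[ab /eqP E]|[/andP[/eqP -> /eqP ->]|/andP[/eqP -> /eqP ->]]]; last 2 first.
- by rewrite xy eqxx.
- by rewrite eq_sym xy tpermC eqxx.
have := congr1 (fun t : 'S_d => t a) E; rewrite tpermL.
case: tpermP => [-> ->|-> ->|_ _ Eb]; [by left; rewrite !eqxx|by right; rewrite !eqxx|].
by rewrite Eb eqxx in ab.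
Qed.

(** A transposition is an edge with its orientation forgotten, hence a factor 2 for each edge, and
    stable sets are closed sets. For [d = 0] the conventions differ: the empty graph is connected,
    but no action on the empty set is transitive. *)
Lemma nb_connected_transitive r d : 0 < d ->
  nb_connected r d = (#|transitive_tuples r d| * 2 ^ r)%N.
Proof.
move=> d0.
pose tau (e : {ffun 'I_r -> 'I_d * 'I_d}) := [ffun i => tperm (e i).1 (e i).2].
have tauE e : (e \in connected_graphs _ _) = loopless e && (tau e \in transitive_tuples r d).
  rewrite [LHS]inE; case: (boolP (loopless e)) => //= /forallP ll.
  rewrite inE (_ : [forall i, _]) /=; last first.
    apply/forallP => i; rewrite ffunE; apply/is_transpP; exists (e i).1, (e i).2.
    by split; first exact: ll.
  apply/graph_connectedP/transitive_genP => [|h B cB|h B /edge_closedP cB].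
  - by rewrite card_ord.
  - apply: h; apply/edge_closedP => i; apply/edge_closed_tperm => u.
    by have := cB i u; rewrite ffunE.
  - by apply: h => i x; rewrite ffunE; move: x; apply/edge_closed_tperm/cB.
rewrite /nb_connected -sum1_card (eq_bigl _ _ tauE).
rewrite (partition_big tau (mem (transitive_tuples r d))) /= => [|e /andP[]//].
rewrite -sum_nat_const; apply: eq_bigr => s sT.
have /forallP sE : [forall i, is_transp (s i)] by move: sT; rewrite inE => /andP[].
rewrite sum1_card.
pose F i := [pred p : 'I_d * 'I_d | (p.1 != p.2) && (tperm p.1 p.2 == s i)].
rewrite (eq_card (B := family F)); last first.
  move=> e; rewrite unfold_in; apply/andP/familyP => [[/andP[/forallP ll _] /eqP E] i|h].
    by rewrite inE ll -E ffunE eqxx.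
  have h' i := andP (h i).
  have E : tau e = s by apply/ffunP => i; rewrite ffunE; apply/eqP; have [] := h' i.
  rewrite E sT eqxx andbT; split=> //; apply/forallP => i; by have [] := h' i.
rewrite card_family foldrE big_map big_enum /= (eq_bigr (fun=> 2)) => [|i _]; last exact: card_tperm_pairs.
by rewrite prod_nat_const card_ord.
Qed.

(* Multiplying by a transposition that joins two classes of [f] also joins two
   cycles of the product, so the bound loses exactly one on both sides. *)
Lemma riemann_hurwitz_labelling (T : finType) r (s : 'I_r -> {perm T}) :
  (forall i, exists x y, x != y /\ s i = tperm x y) ->
  exists f : T -> T, (forall i x, f (s i x) = f x) /\
    #|porbits (\prod_(i < r) s i)%g| + #|T| <= 2 * #|[set f x | x : T]| + r.
Proof.
elim: r s => [|r IH] s tr.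
  exists id; split=> [[]//|]; rewrite big_ord0 addn0 mul2n -addnn.
  by rewrite (card_imset _ (@inj_id T)) leq_add2r leq_imset_card.
have [f [fs fb]] := IH (fun i => s (lift ord0 i)) (fun i => tr _).
have [x [y [xy s0]]] := tr ord0.
rewrite big_ord_recl s0; set p := (\prod_(i < r) _)%g in fb *.
have fp u : f (p u) = f u.
  rewrite /p; elim/big_ind: _ u => [u|a b ha hb u|i _ u]; last exact: fs.
    by rewrite perm1.
  by rewrite permM hb ha.
have := porbits_mul_tperm p x y; rewrite /= xy.
have [E|E] := eqVneq (f x) (f y).
  move=> H; exists f; split; last first.
    have aux a b c t q (z : bool) : a + z.*2 = b + true -> b + t <= 2 * c + q ->
      a + t <= 2 * c + q.+1 by lia.
    exact: aux H fb.
  move=> i u; case: (unliftP ord0 i) => [j ->|->]; first exact: fs.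
  by rewrite s0; case: tpermP => // ->.
(* [f] is constant on the cycles of the product, so different labels mean different cycles. *)
have -> : x \notin porbit p y.
  apply: contra E => /porbitP[i ->]; apply/eqP.
  by elim: i => [|i IHi]; rewrite ?perm1 // expgSr permM fp.
(* The class of [y] is merged into that of [x], which loses at most one label. *)
move=> H; exists (fun u => if f u == f y then f x else f u); split.
  move=> i u; case: (unliftP ord0 i) => [j ->|->]; first by rewrite fs.
  by rewrite s0; case: tpermP => // ->; rewrite eqxx (negbTE E).
set g := fun u => _.
suff: #|[set f u | u : T]| <= #|[set g u | u : T]|.+1.
  have aux a b c c' t q : a + true.*2 = b + true -> b + t <= 2 * c + q -> c <= c'.+1 ->
    a + t <= 2 * c' + q.+1 by lia.
  exact: aux H fb.
rewrite -[_.+1]add1n; apply: leq_trans (_ : #|f y |: [set g u | u : T]| <= _); last first.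
  by rewrite cardsU1 leq_add2r leq_b1.
apply/subset_leq_card/subsetP => _ /imsetP[u _ ->]; rewrite !inE.
have [//|fu] := eqVneq (f u) (f y).
by apply/imsetP; exists u => //; rewrite /g (negbTE fu).
Qed.

(** Labels are constant by transitivity, so at most one class remains. This is [0 <= 2 * g] for the
    covering surface. *)
Lemma riemann_hurwitz r d (s : {ffun 'I_r -> 'S_d}) : s \in transitive_tuples r d ->
  #|porbits (\prod_(i < r) s i)%g| + d <= r + 2.
Proof.
rewrite inE => /andP[/forallP tr trs].
have [f [fs fb]] := riemann_hurwitz_labelling (fun i => is_transpP (s i) (tr i)).
rewrite card_ord in fb; apply: (leq_trans fb); rewrite addnC leq_add2l.
suff h : #|[set f x | x : 'I_d]| <= 1 by apply: (leq_mul (leqnn 2) h).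
have [d0|d0] := leqP #|'I_d| 0.
  by apply: leq_trans (leq_imset_card _ _) _; rewrite (leq_trans d0).
have /card_gt0P[x0 _] := d0.
rewrite -(cards1 (f x0)); apply/subset_leq_card/subsetP => _ /imsetP[u _ ->].
move/(transitive_genP _ d0): trs => /(_ [set u | f u == f x0]) [i x|E|E].
- by rewrite !inE fs.
- by move/setP: E => /(_ x0); rewrite !inE eqxx.
- by move/setP: E => /(_ u); rewrite !inE.
Qed.

Lemma porbits_gt0 (T : finType) (s : {perm T}) : 0 < #|T| -> 0 < #|porbits s|.
Proof. by move=> /card_gt0P[x _]; apply/card_gt0P; exists (porbit s x); apply: imset_f. Qed.

Lemma transitive_tuples_eq0 r d : r.+1 < d -> #|transitive_tuples r d| = 0.
Proof.
move=> rd; apply: eq_card0 => s; apply/negP => /riemann_hurwitz rh.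
have d0 : 0 < #|'I_d| by rewrite card_ord; lia.
have aux a : 0 < a -> a + d <= r + 2 -> False by lia.
exact: aux (porbits_gt0 _ d0) rh.
Qed.

(** The sign of a permutation is the parity of [d] minus its number of cycles. This makes the genus
    an integer. *)
Lemma odd_porbits_prod_transp r d (s : {ffun 'I_r -> 'S_d}) :
  (forall i, is_transp (s i)) -> odd #|porbits (\prod_(i < r) s i)%g| = odd (r + d).
Proof.
move=> tr; have : odd_perm (\prod_(i < r) s i)%g = odd r.
  rewrite (big_morph _ (@odd_permM _) (@odd_perm1 _)) (eq_bigr (fun=> true)) => [|i _].
    rewrite big_const card_ord; elim: r {s tr} => //= r ->.
  by have /is_transpP[x [y [xy ->]]] := tr i; rewrite odd_tperm.
by rewrite /odd_perm card_ord oddD => <-; rewrite -addbA [X in _ (+) X]addbC addbA addbb.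
Qed.

(** * Summation over labelled cycle types *)

(** Write [l] as a vector [lam]. If [mu] rearranges [l], then [aut_card mu] is the number of
    permutations [p] such that [mu] is [lam] composed with [p], and every [p] in ['S_n] produces
    exactly one [mu]. *)
Lemma aut_card_sum n k (l : seq nat) :
  all (leq 1) l -> sumn l = k ->
  \sum_(mu : {ffun 'I_n -> 'I_k.+1} |
      [forall i, 0 < mu i] && (\sum_(i < n) (mu i : nat) == k)%N)
    aut_card (fun i => mu i : nat) * perm_eq l [seq (mu i : nat) | i <- enum 'I_n]
  = n`! * (size l == n).
Proof.
move=> lpos lsum; have [ln|ln] := eqVneq (size l) n; last first.
  rewrite muln0 big1 // => mu _; case: (boolP (perm_eq _ _)) => [/perm_size|]; last by rewrite muln0.
  by rewrite size_map size_enum_ord => E; rewrite E eqxx in ln.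
have lk x : x \in l -> x < k.+1.
  rewrite ltnS -lsum; elim: (l) => //= a l' IH; rewrite inE => /predU1P[->|/IH]; lia.
pose lam (i : 'I_n) : 'I_k.+1 := inord (nth 0 l i).
have lamE (i : 'I_n) : lam i = nth 0 l i :> nat by rewrite inordK // lk // mem_nth // ln.
have lE : l = [seq (lam i : nat) | i <- enum 'I_n].
  apply: (@eq_from_nth _ 0) => [|i il]; first by rewrite size_map size_enum_ord.
  rewrite ln in il; rewrite (nth_map (Ordinal il)) ?size_enum_ord // lamE.
  by rewrite nth_enum_ord.
have permE' (mu : 'I_n -> 'I_k.+1) :
   perm_eq l [seq (mu i : nat) | i <- enum 'I_n] <-> exists p : 'S_n, forall i, mu i = lam (p i).
  rewrite perm_sym {1}lE.
  have := @tuple_permP _ n [seq (mu i : nat) | i <- enum 'I_n] [tuple (lam i : nat) | i < n].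
  move=> tP; split=> [/tP[p E]|[p E]].
    exists p => i; apply: val_inj => /=.
    have := congr1 (fun s => nth 0 s i) E.
    by rewrite (nth_map i) ?size_enum_ord // nth_ord_enum => ->; rewrite -tnth_nth !tnth_mktuple.
  apply/tP; exists p; apply: eq_map => i; by rewrite tnth_mktuple E.
have autE (mu : 'I_n -> 'I_k.+1) :
  (aut_card (fun i => mu i : nat) * perm_eq l [seq (mu i : nat) | i <- enum 'I_n] =
   #|[set p : 'S_n | [forall i, mu i == lam (p i)]]|)%N.
  case: (boolP (perm_eq _ _)) => [/permE'[q qE]|nq]; last first.
    rewrite muln0; apply/esym/eq_card0 => p; rewrite inE; apply/negP => /forallP h.
    by case/negP: nq; apply/permE'; exists p => i; apply/eqP.
  (* If [mu] is [lam] composed with [q], these permutations form a coset of the stabiliser of [mu],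
     reached by multiplication by [q]. *)
  rewrite muln1 /aut_card -(card_imset _ (mulIg q)); apply: eq_card => p; rewrite inE.
  apply/imsetP/forallP => [[a]|h].
    rewrite inE => /forallP h -> i; have /eqP/val_inj <- := h i.
    by rewrite qE permM.
  exists (p * q^-1)%g; last by rewrite mulgKV.
  by rewrite inE; apply/forallP => i; rewrite qE permM permKV (eqP (h i)).
under eq_bigr => mu _ do rewrite autE.
rewrite muln1.
under eq_bigr => mu _ do rewrite -sum1_card big_mkcond.
rewrite exchange_big /= -card_Sn -sum1_card; apply: eq_big => [p|p _]; first by rewrite inE.
rewrite -big_mkcondr /=.
have posl i : 0 < lam i by rewrite lamE (allP lpos) // mem_nth // ln.
rewrite (big_pred1 [ffun i => lam (p i)]) //= => mu.
rewrite inE; apply/andP/eqP => [[_ /forallP h]|->].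
  by apply/ffunP => i; rewrite ffunE; apply/eqP.
split; last by apply/forallP => i; rewrite ffunE.
apply/andP; split; first by apply/forallP => i; rewrite ffunE.
rewrite (eq_bigr (fun i => lam (p i) : nat)) => [|i _]; last by rewrite ffunE.
have lamsum : (\sum_(i < n) (lam i : nat) = k)%N by rewrite -[RHS]lsum [in RHS]lE sumnE big_map big_enum.
by apply/eqP; rewrite -[RHS]lamsum [RHS](reindex_inj (@perm_inj _ p)).
Qed.

Lemma cycle_lengths_pos d (s : 'S_d) : all (leq 1) (cycle_lengths s).
Proof.
apply/allP => _ /mapP[X + ->]; rewrite mem_enum => /imsetP[x _ ->].
by apply/card_gt0P; exists x; apply: porbit_id.
Qed.

Lemma size_cycle_lengths d (s : 'S_d) : size (cycle_lengths s) = #|porbits s|.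
Proof. by rewrite size_map -cardE. Qed.

Lemma sum_cycle_lengths d (s : 'S_d) : sumn (cycle_lengths s) = d.
Proof.
rewrite sumnE big_map big_enum -[RHS](card_ord d) -[RHS]cardsT.
rewrite (card_partition (P := porbits s)) //; apply/and3P; split.
- apply/eqP/setP => x; rewrite inE; apply/bigcupP; exists (porbit s x); first exact: imset_f.
  exact: porbit_id.
- apply/trivIsetP => _ _ /imsetP[x _ ->] /imsetP[y _ ->]; apply: contraR.
  move=> /pred0Pn[z /andP[/= zx zy]]; apply/eqP.
  by rewrite -eq_porbit_mem in zx; rewrite -eq_porbit_mem in zy; rewrite -(eqP zx) (eqP zy).
- apply/imsetP => -[x _ /setP/(_ x)]; by rewrite porbit_id inE.
Qed.

Local Open Scope ring_scope.

(** The number of branch points depends on [mu] only through its size, so the sum over [mu] can be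
    exchanged with the sum over tuples, where it keeps only the number of cycles. *)
Lemma F_diag_coefE g n k :
  F_diag_coef g n k = (n`!)%:R / ((nb_branch g n k)`! * k`!)%:R *
    #|[set s in transitive_tuples (nb_branch g n k) k |
        #|porbits (\prod_(i < nb_branch g n k) s i)%g| == n]|%:R.
Proof.
rewrite /F_diag_coef; set r := nb_branch g n k.
rewrite (eq_bigr (fun mu : {ffun 'I_n -> 'I_k.+1} => (r`! * k`!)%:R^-1 *
  (\sum_(s in transitive_tuples r k) aut_card (fun i => mu i : nat) *
    perm_eq (cycle_lengths (\prod_(i < r) s i)%g) [seq (mu i : nat) | i <- enum 'I_n])%N%:R)).
  rewrite -big_distrr -natr_sum exchange_big /= mulrAC [in RHS]mulrC; congr (_ * _).
  under eq_bigr => s _ do rewrite (aut_card_sum _ (cycle_lengths_pos _) (sum_cycle_lengths _)).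
  rewrite -big_distrr natrM /=; congr (_ * _%:R).
  rewrite -sum1_card big_mkcond [RHS]big_mkcond; apply: eq_bigr => s _.
  by rewrite [in RHS]inE size_cycle_lengths; case: (_ \in _); case: (_ == _).
move=> mu /andP[_ /eqP musum]; rewrite /H_hur /h_hur /msize musum -/r.
rewrite -big_distrr natrM [in RHS]natrM invfM /=.
rewrite (_ : hurwitz_count _ _ _ = (\sum_(s in transitive_tuples r k)
  perm_eq (cycle_lengths (\prod_(i < r) s i)%g) [seq (mu i : nat) | i <- enum 'I_n])%N).
  by ring.
rewrite /hurwitz_count -sum1_card big_mkcond [RHS]big_mkcond; apply: eq_bigr => s _.
by rewrite !inE /has_cycle_type; case: [forall i, _] => //=; case: (atrans _ _ _) => //=; case: (perm_eq _ _).
Qed.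

(** For [n = m + 1 - 2 * g] the number [nb_branch g n k] is [k + m - 1] whatever [g] is, so the
    terms of [S_H m] sort the same tuples by their number of cycles. *)
Lemma S_HE m k : (0 < k)%N ->
  S_H m k = #|transitive_tuples (k + m - 1) k|%:R / ((k + m - 1)`! * k`!)%:R.
Proof.
move=> k0; set r := (k + m - 1)%N.
pose cyc (s : {ffun 'I_r -> 'S_k}) := #|porbits (\prod_(i < r) s i)%g|.
(* Riemann-Hurwitz gives at most [m + 1] cycles, and parity gives the congruence with [m + 1] modulo
   2. *)
have cycE s : s \in transitive_tuples r k ->
    exists2 g : 'I_m.+1, (2 * g <= m)%N & cyc s = (m.+1 - 2 * g)%N.
  move=> sT; have rh := riemann_hurwitz sT.
  have od : odd (cyc s) = odd (r + k).
    by apply: odd_porbits_prod_transp; apply/forallP; move: sT; rewrite inE => /andP[].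
  have c0 : (0 < cyc s)%N by apply: porbits_gt0; rewrite card_ord.
  rewrite -/(cyc s) in rh; move: (cyc s) rh od c0 => c rh od c0.
  have lt : ((m.+1 - c)./2 < m.+1)%N by lia.
  by exists (Ordinal lt) => /=; move: od; rewrite /r; lia.
transitivity (\sum_(g < m.+1 | (2 * g <= m)%N)
    #|[set s in transitive_tuples r k | cyc s == (m.+1 - 2 * g)%N]|%:R / (r`! * k`!)%:R : rat).
  apply: eq_bigr => g gm; rewrite F_diag_coefE.
  have -> : nb_branch g (m.+1 - 2 * g) k = r by rewrite /nb_branch /r; lia.
  by rewrite mulrA mulrA mulVf ?mul1r 1?mulrC // pnatr_eq0 -lt0n fact_gt0.
rewrite -big_distrl /= -natr_sum; congr (_%:R / _).
under eq_bigr => g _ do rewrite -sum1_card big_mkcond.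
rewrite exchange_big -sum1_card [RHS]big_mkcond /=; apply: eq_bigr => s _.
under eq_bigr => g _ do rewrite inE.
case: (boolP (s \in _)) => [sT|_]; last by rewrite big1.
have [g gm cg] := cycE s sT.
rewrite (bigD1 g) //= -/(cyc s) cg eqxx big1 // => h /andP[hm hg].
case: eqP => // E; case/eqP: hg; apply: val_inj => /=; move: E gm hm; lia.
Qed.

(** * The recursion for the weighted counts *)

(** Dividing by [2 ^ r] forgets orientations, and the two factorials make the count exponential in
    edges and in vertices, which absorbs the binomials of the recursion. *)
Definition conn_wt (r k : nat) : rat :=
  (nb_connected r k)%:R / ((2 ^ r * r`!)%N%:R * (k`!)%:R).

Lemma fact_neq0 n : (n`!)%:R != 0 :> rat.
Proof. by rewrite pnatr_eq0 -lt0n fact_gt0. Qed.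

Lemma S_H0 m : S_H m 0%N = 0.
Proof.
rewrite /S_H big1 // => g gm; rewrite /F_diag_coef big1 ?mulr0 // => mu /andP[/forallP h _].
have n0 : (0 < m.+1 - 2 * g)%N by lia.
by have := h (Ordinal n0); rewrite ltnNge -ltnS ltn_ord.
Qed.

Lemma S_H_conn_wt m k : (0 < k)%N -> S_H m k = conn_wt (k + m - 1) k.
Proof.
move=> k0; rewrite S_HE // /conn_wt nb_connected_transitive // !natrM.
have := fact_neq0 (k + m - 1); have := fact_neq0 k.
have : (2 ^ (k + m - 1))%:R != 0 :> rat by rewrite pnatr_eq0 expn_eq0.
by move=> h1 h2 h3; field; rewrite h1 h2 h3.
Qed.

Lemma conn_wt_eq0 r k : (r.+1 < k)%N -> conn_wt r k = 0.
Proof.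
move=> rk; rewrite /conn_wt nb_connected_transitive ?transitive_tuples_eq0 ?mul0n ?mul0r //.
exact: leq_ltn_trans rk.
Qed.

Lemma bin_fact_div n i : (i <= n)%N -> ('C(n, i))%:R = (n`!)%:R / ((i`!)%:R * ((n - i)`!)%:R) :> rat.
Proof.
move=> ni; rewrite -(bin_fact ni) !natrM mulfK //.
by rewrite mulf_neq0 ?fact_neq0.
Qed.

Lemma conn_wt_rec r k :
  (r.+1)%:R * conn_wt r.+1 k = 1 / 2%:R * ((k * k.-1)%:R * conn_wt r k +
    \sum_(i < k.+1) (i * (k - i))%:R * \sum_(j < r.+1) conn_wt j i * conn_wt (r - j) (k - i)).
Proof.
pose c : rat := (2 ^ r.+1 * r`!)%N%:R * (k`!)%:R.
have p2 n : (2 ^ n)%:R != 0 :> rat by rewrite pnatr_eq0 expn_eq0.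
have c0 : c != 0 by rewrite /c natrM !mulf_neq0 ?fact_neq0.
have r0 : r.+1%:R != 0 :> rat by rewrite pnatr_eq0.
have r0' : 1 + r%:R != 0 :> rat by rewrite addrC natr1.
apply: (mulfI c0).
transitivity ((nb_connected r.+1 k)%:R : rat).
  rewrite /conn_wt /c factS !natrM expnS !natrM; field.
  by rewrite !fact_neq0 r0' p2.
rewrite nb_connected_rec natrD mulrA mulrDr; congr (_ + _).
  rewrite /conn_wt /c expnS !natrM; field.
  by rewrite !fact_neq0 p2.
rewrite natr_sum big_distrr /=; apply: eq_bigr => i _.
have ik : (i <= k)%N by rewrite -ltnS.
rewrite !natrM natr_sum bin_fact_div // !big_distrr /=; apply: eq_bigr => j _.
have jr : (j <= r)%N by rewrite -ltnS.
rewrite !natrM bin_fact_div // /conn_wt /c -[in (2 ^ r.+1)%N](subnK jr) -addSn expnD expnS !natrM; field.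
by rewrite !fact_neq0 !p2.
Qed.

Lemma sum_window (F : nat -> rat) p q n : 
  (forall j, (j < p)%N -> F j = 0) -> (forall j, (p + n <= j < p + n + q)%N -> F j = 0) ->
  \sum_(j < p + n + q) F j = \sum_(a < n) F (p + a)%N.
Proof.
move=> h1 h2; rewrite -[LHS](big_mkord xpredT F) (@big_cat_nat _ _ _ p) ?leq0n //=; last by lia.
rewrite [X in X + _]big_nat big1 ?add0r => [|j /andP[_]]; last exact: h1.
rewrite (@big_cat_nat _ _ _ (p + n)) /= ?leq_addr //.
rewrite [X in _ + X]big_nat [X in _ + X]big1 ?addr0 //.
by rewrite -{1}[p]add0n big_addn addKn big_mkord; apply: eq_bigr => i _; rewrite addnC.
Qed.

(** With [k + M - 1] edges on [k] vertices, [M] is the first Betti number of a connected graph.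
    Deleting an edge lowers it by one, or leaves two components whose Betti numbers add up to
    [M]. *)
Lemma S_H_rec M k :
  (k + M - 1)%:R * S_H M k = 1 / 2%:R *
    ((if M is M'.+1 then (k * k.-1)%:R * S_H M' k else 0) +
     \sum_(i < k.+1) (i * (k - i))%:R * \sum_(a < M.+1) S_H a i * S_H (M - a) (k - i)%N).
Proof.
case: k => [|k].
  rewrite S_H0 mulr0 big_ord1 mul0r addr0; case: M => [|M]; rewrite ?mulr0 //.
  by rewrite mul0n mul0r mulr0.
(* A single vertex without edges has no edge to delete; here both sides vanish. *)
have [M1|kM] := leqP (k.+1 + M) 1.
  have [-> ->] : k = 0%N /\ M = 0%N by lia.
  rewrite mul0r add0r big1 ?mulr0 // => -[[|[|i]] // hi] _; by rewrite ?mul0n ?subnn ?muln0 mul0r.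
have [r rE] : exists r, (k.+1 + M - 1 = r.+1)%N by exists (k + M).-1; lia.
rewrite S_H_conn_wt // rE conn_wt_rec; congr (_ * (_ + _)).
  (* A tree has only bridges, so for [M = 0] the first term vanishes. *)
  case: M rE {kM} => [|M] rE; first by rewrite conn_wt_eq0 ?mulr0 //; lia.
  by rewrite S_H_conn_wt //; congr (_ * conn_wt _ _); lia.
apply: eq_bigr => i _.
have [i0|i0] := posnP (i * (k.+1 - i)); first by rewrite i0 !mul0r.
have [i1 i2] : (0 < i)%N /\ (0 < k.+1 - i)%N by move: i0; rewrite muln_gt0 => /andP[].
congr (_ * _).
(* A connected graph on [i] vertices has [i - 1 + a] edges for some [a >= 0], and likewise for the
   other part. Outside this window of [M + 1] values one factor is zero. *)
have -> : r.+1 = ((i - 1) + M.+1 + (k - i))%N by lia.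
rewrite (@sum_window (fun j => conn_wt j i * conn_wt (r - j) (k.+1 - i))).
- apply: eq_bigr => a _; rewrite !S_H_conn_wt //; congr (conn_wt _ _ * conn_wt _ _).
    by lia.
  by have := ltn_ord a; lia.
- by move=> j ji; rewrite conn_wt_eq0 ?mul0r //; lia.
- by move=> j ji; rewrite mulrC conn_wt_eq0 ?mul0r //; lia.
Qed.

(** For one vertex and [M = 0] the recursion reads [0 = 0], so this initial value is computed
    directly. *)
Lemma S_H0_1 : S_H 0 1%N = 1.
Proof.
rewrite S_H_conn_wt // /conn_wt /=.
suff -> : nb_connected 0 1 = 1%N by [].
rewrite /nb_connected (_ : connected_graphs _ _ = setT) ?cardsT ?card_ffun ?card_ord //.
apply/setP => e; rewrite !inE; apply/andP; split; first by apply/forallP => -[].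
apply/graph_connectedP => B _; have [->|[x xB]] := set_0Vmem B; [by left|right].
by apply/setP => y; rewrite inE (ord1 y) -(ord1 x).
Qed.

(** * The ring of power series *)

Section PowerSeriesRing.
Implicit Types f g h : fps.

Definition fps_add f g : fps := fun k => f k + g k.
Definition fps_opp f : fps := fun k => - f k.
Definition fps_zero : fps := fun=> 0.
Definition fps_trunc n f : {poly rat} := \poly_(i < n) f i.

(** Coefficients up to [k] only see truncations, so ring laws are inherited from polynomials. *)
Lemma fps_mul_trunc n f g k : (k < n)%N ->
  fps_mul f g k = (fps_trunc n f * fps_trunc n g)`_k.
Proof.
move=> kn; rewrite coefM; apply: eq_bigr => i _; rewrite !coef_poly.
by rewrite (leq_trans (ltn_ord i) kn) (leq_ltn_trans (leq_subr _ _) kn).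
Qed.

Lemma fps_addA : associative fps_add.
Proof. by move=> f g h; apply/funext => k; rewrite /fps_add addrA. Qed.
Lemma fps_addC : commutative fps_add.
Proof. by move=> f g; apply/funext => k; rewrite /fps_add addrC. Qed.
Lemma fps_add0 : left_id fps_zero fps_add.
Proof. by move=> f; apply/funext => k; rewrite /fps_add add0r. Qed.
Lemma fps_addN : left_inverse fps_zero fps_opp fps_add.
Proof. by move=> f; apply/funext => k; rewrite /fps_add addNr. Qed.

Lemma fps_mulC : commutative fps_mul.
Proof.
by move=> f g; apply/funext => k; rewrite !(@fps_mul_trunc k.+1) // mulrC.
Qed.

Lemma fps_mulA : associative fps_mul.
Proof.
move=> f g h; apply/funext => k.
transitivity ((fps_trunc k.+1 f * (fps_trunc k.+1 g * fps_trunc k.+1 h))`_k).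
  rewrite coefM; apply: eq_bigr => i _; rewrite coef_poly ltn_ord; congr (_ * _).
  by rewrite (@fps_mul_trunc k.+1) // ltnS leq_subr.
rewrite mulrA coefM; apply: eq_bigr => i _; rewrite coef_poly ltnS leq_subr; congr (_ * _).
by rewrite (@fps_mul_trunc k.+1).
Qed.

Lemma fps_mul1 : left_id fps_one fps_mul.
Proof.
move=> f; apply/funext => k; rewrite /fps_mul big_ord_recl /fps_one /= mul1r subn0.
by rewrite big1 ?addr0 // => i _; rewrite mul0r.
Qed.

Lemma fps_mulDl : left_distributive fps_mul fps_add.
Proof.
move=> f g h; apply/funext => k; rewrite /fps_mul /fps_add -big_split /=.
by apply: eq_bigr => i _; rewrite mulrDl.
Qed.

End PowerSeriesRing.

HB.instance Definition _ := gen_eqMixin fps.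
HB.instance Definition _ := gen_choiceMixin fps.
HB.instance Definition _ := GRing.isZmodule.Build fps fps_addA fps_addC fps_add0 fps_addN.
Lemma fps_one_neq0 : fps_one != 0 :> fps.
Proof. by apply/eqP => /(congr1 (fun f : fps => f 0%N)) /eqP; rewrite oner_eq0. Qed.
HB.instance Definition _ :=
  GRing.Zmodule_isComNzRing.Build fps fps_mulA fps_mulC fps_mul1 fps_mulDl fps_one_neq0.


Lemma fps0E k : (0 : fps) k = 0. Proof. by []. Qed.
Lemma fps1E k : (1 : fps) k = (k == 0%N)%:R. Proof. by []. Qed.
Lemma fpsDE (f g : fps) k : (f + g) k = f k + g k. Proof. by []. Qed.
Lemma fpsNE (f : fps) k : (- f) k = - f k. Proof. by []. Qed.
Lemma fpsME (f g : fps) k : (f * g) k = \sum_(i < k.+1) f i * g (k - i)%N.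
Proof. by []. Qed.

Lemma fps_sumE (I : Type) (r : seq I) (P : pred I) (F : I -> fps) k :
  (\sum_(i <- r | P i) F i) k = \sum_(i <- r | P i) F i k.
Proof. exact: (big_morph (fun f : fps => f k) (fun f g => fpsDE f g k) (fps0E k)). Qed.

Lemma fps_powE (f : fps) i : fps_pow f i = f ^+ i.
Proof. by elim: i => // i IH; rewrite exprS -IH. Qed.

Definition fps_const (c : rat) : fps := fun k => if k == 0%N then c else 0.

Lemma fps_constM c (f : fps) k : (fps_const c * f) k = c * f k.
Proof.
rewrite fpsME big_ord_recl /fps_const /= subn0 big1 ?addr0 // => i _.
by rewrite mul0r.
Qed.

Lemma fps_const_is_zmod : zmod_morphism fps_const.
Proof.
by move=> a b; apply/funext => -[|k]; rewrite fpsDE fpsNE /fps_const //= subr0.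
Qed.

Lemma fps_const_is_monoid : monoid_morphism fps_const.
Proof.
split; first by apply/funext => -[].
by move=> a b; apply/funext => k; rewrite fps_constM /fps_const; case: k => //=; rewrite mulr0.
Qed.

HB.instance Definition _ := GRing.isZmodMorphism.Build rat fps fps_const fps_const_is_zmod.
HB.instance Definition _ := GRing.isMonoidMorphism.Build rat fps fps_const fps_const_is_monoid.

(* The Euler operator x d/dx = - d/dw. *)
Definition euler (f : fps) : fps := fun k => k%:R * f k.

Lemma eulerD f g : euler (f + g) = euler f + euler g.
Proof. by apply/funext => k; rewrite /euler !fpsDE mulrDr. Qed.

Lemma eulerN f : euler (- f) = - euler f.
Proof. by apply/funext => k; rewrite /euler !fpsNE mulrN. Qed.

Lemma eulerM f g : euler (f * g) = euler f * g + f * euler g.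
Proof.
apply/funext => k; rewrite /euler fpsDE !fpsME big_distrr /= -big_split /=.
apply: eq_bigr => i _; have ik : (i <= k)%N by rewrite -ltnS.
by rewrite -{1}(subnKC ik) natrD; ring.
Qed.

Lemma euler_const c : euler (fps_const c) = 0.
Proof. by apply/funext => -[|k]; rewrite /euler /fps_const /= ?mul0r ?mulr0. Qed.

Lemma fps_natE n : n%:R = fps_const n%:R. Proof. by rewrite rmorph_nat. Qed.

(** * The tree function *)

(* Applies (X d/dX)^m to (X - 1)^n and evaluates at 1. *)
Lemma alternating_power_sum n m : (m < n)%N ->
  \sum_(i < n.+1) (-1) ^+ (n - i) * 'C(n, i)%:R * i%:R ^+ m = 0 :> rat.
Proof.
pose theta (p : {poly rat}) : {poly rat} := 'X * p^`().
have step l : (l <= n)%N -> exists q : {poly rat},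
    iter l theta (('X - 1) ^+ n) = ('X - 1) ^+ (n - l) * q.
  elim: l => [_|l IH ln]; first by exists 1; rewrite subn0 mulr1.
  have [q E] := IH (ltnW ln); rewrite iterS E /theta derivM.
  exists ('X * (q *+ (n - l) + ('X - 1) * q^`())).
  have -> : (n - l = (n - l.+1).+1)%N by lia.
  rewrite deriv_exp /= derivB derivX derivC subr0 mul1r.
  by rewrite exprS; ring.
have iterE l : iter l theta (('X - 1) ^+ n) =
    \sum_(i < n.+1) ((-1) ^+ (n - i) * 'C(n, i)%:R * i%:R ^+ l) *: 'X^i.
  elim: l => [|l IH].
    rewrite /= addrC exprDn; apply: eq_bigr => i _.
    by rewrite expr0 mulr1 -scalerA scaler_nat -mul_polyC rmorphXn /= polyCN polyC1 mulrnAr.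
  rewrite iterS IH /theta raddf_sum big_distrr /=; apply: eq_bigr => i _.
  rewrite derivZ derivXn -scalerAr exprSr mulrA -[RHS]scalerA.
  case: (i : nat) => [|i'] /=; first by rewrite mulr0n mulr0 scale0r.
  by congr (_ *: _); rewrite mulrnAr -exprS scaler_nat.
move=> mn; have [q E] := step m (ltnW mn).
move: (congr1 (fun p : {poly rat} => p.[1]) E).
rewrite iterE horner_sum hornerM horner_exp !hornerE subrr expr0n subn_eq0 leqNgt mn /= mul0r => E'.
rewrite -[RHS]E'; apply: eq_bigr => i _; by rewrite !hornerE expr1n mulr1.
Qed.

(* The case x = 0 of Abel's binomial identity, by integration in X. *)
Lemma abel_identity k :
  \sum_(j < k.+1) ('C(k.+1, j.+1)%:R * j.+1%:R ^+ j) *: ('X - (j.+1%:R)%:P) ^+ (k - j)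
  = k.+1%:R *: 'X^k :> {poly rat}.
Proof.
elim: k => [|k IH]; first by rewrite big_ord1 binn mul1r subnn !expr0.
set P := LHS; set Q := RHS.
have dPQ : P^`() = Q^`().
  rewrite /P /Q raddf_sum derivZ derivXn /= -scaler_nat.
  rewrite -IH scaler_sumr big_ord_recr /= subnn expr0 alg_polyC derivC addr0.
  apply: eq_bigr => j _; rewrite derivZ deriv_exp derivXsubC mul1r.
  have jk : (j <= k)%N by rewrite -ltnS.
  rewrite -scaler_nat subSn //= !scalerA; congr (_ *: _).
  have E : k.+2%:R * 'C(k.+1, j.+1)%:R = (k - j).+1%:R * 'C(k.+2, j.+1)%:R :> rat.
    by rewrite -!natrM mul_bin_down subSS subSn.
  by rewrite [RHS]mulrA E; ring.
(* At 0 the left side is an alternating sum of powers of exponent [k + 1 < k + 2], hence zero like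
   the right side. *)
have P0 : P.[0] = Q.[0].
  rewrite /P /Q hornerZ hornerXn expr0n mulr0 horner_sum.
  have := @alternating_power_sum k.+2 k.+1 (ltnSn _).
  rewrite big_ord_recl expr0n mulr0 add0r => E; rewrite -[RHS]E; apply: eq_bigr => j _.
  have jk : (j <= k.+1)%N by rewrite -ltnS.
  rewrite hornerZ horner_exp hornerXsubC sub0r lift0 subSS.
  have -> : j.+1%:R ^+ k.+1 = j.+1%:R ^+ j * j.+1%:R ^+ (k.+1 - j) :> rat by rewrite -exprD subnKC.
  by rewrite -[- j.+1%:R]mulN1r exprMn; ring.
have : (P - Q)^`() = 0 by rewrite derivB dPQ subrr.
move=> dz; apply/eqP; rewrite -subr_eq0; apply/eqP/polyP => -[|i].
  by rewrite -horner_coef0 hornerD hornerN P0 subrr coef0.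
have := congr1 (fun p : {poly rat} => p`_i) dz; rewrite coef_deriv coef0 => /eqP.
by rewrite mulrn_eq0 /= coef0 => /eqP.
Qed.

(** The exponential generating function of rooted labelled trees, the solution [z] of
    [x = z exp(- z)]. *)
Definition tree_fps : fps := fun k => if k is k'.+1 then k%:R ^+ k' / k`!%:R else 0.

Lemma t_fpsE k : t_fps k = k%:R ^+ k / k`!%:R.
Proof. by case: k => [|k]; rewrite /t_fps /= ?fact0 ?divr1 // natrX. Qed.

Lemma euler_tree : euler tree_fps = t_fps - 1.
Proof.
apply/funext => -[|k]; rewrite fpsDE fpsNE t_fpsE /euler; first by rewrite mul0r.
by rewrite fps1E subr0 /= exprS mulrA.
Qed.

Lemma tree_mul_t : tree_fps * t_fps = t_fps - 1.
Proof.
apply/funext => -[|k]; rewrite fpsDE fpsNE fpsME; first by rewrite big_ord1 mul0r.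
rewrite big_ord_recl mul0r add0r fps1E subr0 t_fpsE.
(* Abel's identity at [X = k + 1], divided by the factorial, is the required convolution. *)
have := congr1 (fun p : {poly rat} => p.[k.+1%:R] / k.+1`!%:R) (abel_identity k).
rewrite hornerZ hornerXn -exprS => <-; rewrite horner_sum big_distrl /=.
apply: eq_bigr => j _; have jk : (j <= k)%N by rewrite -ltnS.
rewrite hornerZ horner_exp hornerXsubC t_fpsE /bump /= add1n subSS.
rewrite -natrB // subSS bin_fact_div // subSS.
have h1 := fact_neq0 j.+1; have h2 := fact_neq0 (k - j); have h3 := fact_neq0 k.+1.
by field; rewrite h1 h2 h3.
Qed.

(** Applying [D = euler] to [z t = t - 1] gives [(1 - z) D t = t (t - 1)], and multiplication by [t]
    inverts [1 - z]. *)
Lemma euler_t : euler t_fps = t_fps ^+ 2 * (t_fps - 1).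
Proof.
have tz := tree_mul_t; have := congr1 euler tz.
rewrite eulerM euler_tree eulerD eulerN -(rmorph1 fps_const) euler_const oppr0 addr0 rmorph1 => H.
have -> : euler t_fps = t_fps * (euler t_fps - tree_fps * euler t_fps) +
                         (tree_fps * t_fps - (t_fps - 1)) * euler t_fps by ring.
by rewrite tz subrr mul0r addr0 -{1}H; ring.
Qed.

(** * The series S_0 and S_1, and the linear equation for the others *)

(** In degree [k] the equation determines [k - 1] times the coefficient from lower ones, as the
    extreme terms of the product vanish. Degree 1 is left free, hence the hypothesis on it. *)
Lemma euler_quadratic_uniq (f g : fps) :
  f 0%N = 0 -> g 0%N = 0 -> f 1%N = g 1%N ->
  euler f - f = f * euler f -> euler g - g = g * euler g -> f = g.
Proof.
move=> f0 g0 fg1 hf hg; apply/funext => k.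
elim/ltn_ind: k => -[|[|k]] IH; [by rewrite f0 g0|by []|].
have k1 : k.+1%:R != 0 :> rat by rewrite pnatr_eq0.
apply: (mulfI k1).
have ef (h : fps) : euler h - h = h * euler h -> k.+1%:R * h k.+2 = (h * euler h) k.+2.
  by move=> <-; rewrite fpsDE fpsNE /euler -[k.+2]addn1 natrD; ring.
rewrite !ef // !fpsME; apply: eq_bigr => i _.
have [->|i0] := posnP i; first by rewrite f0 g0 !mul0r.
have [ik|ik] := eqVneq (i : nat) k.+2; first by rewrite ik subnn /euler !mul0r !mulr0.
rewrite /euler !IH //; have := ltn_ord i; lia.
Qed.

(** As [tree_fps] has no constant term, [k + m] times the coefficient of degree [k] of the
    difference is a combination of lower ones; [0 < m] also settles degree 0. *)
Lemma euler_linear_uniq m (f g : fps) : (0 < m)%N ->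
  (1 - tree_fps) * euler f + m%:R * f = (1 - tree_fps) * euler g + m%:R * g -> f = g.
Proof.
move=> m0 E; have : (1 - tree_fps) * euler (f - g) + m%:R * (f - g) = 0.
  by rewrite eulerD eulerN -[RHS](subrr ((1 - tree_fps) * euler f + m%:R * f)) {2}E; ring.
move: (f - g) (subr0_eq (x := f) (y := g)) => h hE H; apply: hE.
apply/funext => k; elim/ltn_ind: k => k IH.
have := congr1 (fun f : fps => f k) H; rewrite mulrBl mul1r fps_natE !fpsDE fps_constM fpsNE fpsME.
rewrite big1 ?subr0 => [|i _].
  rewrite /euler -mulrDl -natrD fps0E => /eqP; rewrite mulf_eq0 pnatr_eq0 => /orP[|/eqP//]; lia.
have [->|i0] := posnP i; first by rewrite mul0r.
by rewrite /euler IH ?fps0E ?mulr0 //; have := ltn_ord i; lia.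
Qed.

Definition fps_half := fps_const (1 / 2%:R).

Lemma fps_halfD : fps_half + fps_half = 1.
Proof. by rewrite -rmorphD -mulrDr -(rmorph1 fps_const). Qed.

Lemma S_H0_series : euler (S_H 0) - S_H 0 = fps_half * euler (S_H 0) ^+ 2.
Proof.
apply/funext => k; rewrite fps_constM expr2 fpsDE fpsNE fpsME.
transitivity ((k + 0 - 1)%:R * S_H 0 k).
  (* At [k = 0] the subtraction truncates, but both sides vanish. *)
  case: k => [|k]; first by rewrite /euler S_H0 !mulr0 subr0.
  by rewrite addn0 subn1 /euler /= -natr1; ring.
rewrite S_H_rec add0r; congr (_ * _); apply: eq_bigr => i _.
by rewrite big_ord1 subn0 /euler natrM; ring.
Qed.

(** Conjugation by [exp(- m w)] turns [d/dw] into [- (D + m)], so this is the recursion to be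
    proved; the factor [k (k - 1)] becomes [D^2 - D]. *)
Lemma S_H_series m :
  euler (S_H m.+1) + m%:R * S_H m.+1 = fps_half *
    (euler (euler (S_H m)) - euler (S_H m) +
     \sum_(a < m.+2) euler (S_H a) * euler (S_H (m.+1 - a))).
Proof.
apply/funext => k; rewrite fps_natE !fpsDE !fps_constM !fpsDE fpsNE fps_sumE.
transitivity ((k + m.+1 - 1)%:R * S_H m.+1 k).
  by rewrite addnS subn1 /euler natrD; ring.
rewrite S_H_rec; congr (_ * (_ + _)).
  by case: k => [|k]; rewrite /euler ?S_H0 ?mulr0 ?subr0 // natrM /= -[k.+1%:R]natr1; ring.
under eq_bigr => i _ do rewrite big_distrr.
rewrite exchange_big; apply: eq_bigr => a _; rewrite fpsME; apply: eq_bigr => i _.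
by rewrite /euler natrM /=; ring.
Qed.

(** Differentiating [S_H0_series] eliminates [S_H 0]: both series satisfy [D z - z = z D z] with
    first coefficient 1. *)
Lemma euler_S_H0 : euler (S_H 0) = tree_fps.
Proof.
apply: euler_quadratic_uniq.
- by rewrite /euler mul0r.
- by [].
- by rewrite /euler S_H0_1 /tree_fps /=.
- have := congr1 euler S_H0_series; rewrite eulerD eulerN => ->.
  rewrite expr2 !eulerM euler_const.
  by rewrite -[RHS]mul1r -fps_halfD; ring.
- by rewrite euler_tree mulrDr tree_mul_t; ring.
Qed.

(** For [m = 0] the recursion reads [(1 - z) D S_1 = (t - 1 - z) / 2], which is then multiplied by
    [t]. *)
Lemma euler_S_H1 : euler (S_H 1) = fps_half * (t_fps - 1) ^+ 2.
Proof.
have tz := tree_mul_t; have := S_H_series 0.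
rewrite mul0r addr0 !big_ord_recl big_ord0 /= addr0 /bump /= subn0 subnn euler_S_H0 euler_tree.
set d := euler (S_H 1) => H.
have -> : d = t_fps * (d - fps_half * (tree_fps * d + d * tree_fps)) +
   ((fps_half + fps_half) * (tree_fps * t_fps) - (t_fps - 1)) * d by ring.
rewrite fps_halfD mul1r tz subrr mul0r addr0 {1}H.
have -> : t_fps * (fps_half * (t_fps - 1 - tree_fps + (tree_fps * d + d * tree_fps)) -
                  fps_half * (tree_fps * d + d * tree_fps))
  = fps_half * (t_fps * (t_fps - 1) - tree_fps * t_fps) by ring.
by rewrite tz; ring.
Qed.

(** The extreme terms of the sum contain the unknown [D S_(m+1)] with the factor [z]; moving them to
    the left produces [1 - z]. *)
Lemma S_H_linear m : (0 < m)%N ->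
  (1 - tree_fps) * euler (S_H m.+1) + m%:R * S_H m.+1 = fps_half *
    (euler (euler (S_H m)) - euler (S_H m) +
     \sum_(a < m) euler (S_H a.+1) * euler (S_H (m - a))).
Proof.
move=> m0; have := S_H_series m; rewrite big_ord_recl big_ord_recr /= subn0 subnn euler_S_H0.
rewrite (eq_bigr (fun a : 'I_m => euler (S_H a.+1) * euler (S_H (m - a)))) => [H|a _]; last first.
  by rewrite /bump /= add1n subSS.
set d := euler (S_H m.+1) in H *; set s := \sum_(a < m) _ in H *.
transitivity (d + m%:R * S_H m.+1 - (fps_half + fps_half) * (tree_fps * d)); first by rewrite fps_halfD; ring.
by rewrite H; ring.
Qed.

(** * Polynomials in t *)

Definition fps_eval (p : {poly rat}) : fps := (map_poly fps_const p).[t_fps].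

Lemma fps_of_polyE p : fps_of_poly p t_fps = fps_eval p.
Proof.
apply/funext => k; rewrite /fps_eval horner_coef fps_sumE size_map_poly.
by apply: eq_bigr => i _; rewrite coef_map /= fps_constM fps_powE.
Qed.

Lemma fps_evalD p q : fps_eval (p + q) = fps_eval p + fps_eval q.
Proof. by rewrite /fps_eval rmorphD hornerD. Qed.
Lemma fps_evalB p q : fps_eval (p - q) = fps_eval p - fps_eval q.
Proof. by rewrite /fps_eval rmorphB hornerD hornerN. Qed.
Lemma fps_evalM p q : fps_eval (p * q) = fps_eval p * fps_eval q.
Proof. by rewrite /fps_eval rmorphM hornerM. Qed.
Lemma fps_evalC c : fps_eval c%:P = fps_const c.
Proof. by rewrite /fps_eval map_polyC hornerC. Qed.
Lemma fps_eval1 : fps_eval 1 = 1. Proof. by rewrite fps_evalC rmorph1. Qed.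
Lemma fps_evalX : fps_eval 'X = t_fps.
Proof. by rewrite /fps_eval map_polyX hornerX. Qed.
Lemma fps_eval_sum (I : Type) (r : seq I) (P : pred I) (F : I -> {poly rat}) :
  fps_eval (\sum_(i <- r | P i) F i) = \sum_(i <- r | P i) fps_eval (F i).
Proof. by apply: (big_morph _ fps_evalD); rewrite fps_evalC rmorph0. Qed.

(** The series [t_fps] starts with 1, so evaluation at [t = 1] reads off the constant term. *)
Lemma fps_eval_at0 p : fps_eval p 0%N = p.[1].
Proof.
elim/poly_ind: p => [|p c IH]; first by rewrite fps_evalC horner0.
rewrite fps_evalD fps_evalM fps_evalX fps_evalC fpsDE fpsME big_ord1 IH !hornerE.
by [].
Qed.

Lemma euler_fps_eval p : euler (fps_eval p) = fps_eval ('X^2 * ('X - 1) * p^`()).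
Proof.
rewrite !(fps_evalM, fps_evalB, fps_evalX, fps_eval1, expr2).
elim/poly_ind: p => [|p c IH].
  by rewrite fps_evalC euler_const deriv0 fps_evalC rmorph0 mulr0.
rewrite derivMXaddC !fps_evalD !fps_evalM fps_evalX fps_evalC eulerD euler_const eulerM IH euler_t.
by ring.
Qed.

(** * Exact degrees and the linear differential equation *)

(** Positivity of the leading coefficient excludes cancellation in sums, so that degrees stay
    exact. *)
Definition lead_pos n (p : {poly rat}) := (size p <= n.+1)%N /\ 0 < p`_n.

Lemma lead_posD n (p q : {poly rat}) : lead_pos n p -> (size q <= n.+1)%N -> 0 <= q`_n -> lead_pos n (p + q).
Proof.
move=> [sp lp] sq lq; split; last by rewrite coefD ltr_wpDr.
by rewrite (leq_trans (size_polyD _ _)) // geq_max sp.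
Qed.

Lemma lead_posM n k p q : lead_pos n p -> lead_pos k q -> lead_pos (n + k) (p * q).
Proof.
move=> [sp lp] [sq lq]; split.
  by rewrite (leq_trans (size_polyMleq _ _)) //; lia.
rewrite coefM (bigD1 (inord n)) //= inordK ?ltnS ?leq_addr // addKn big1 ?addr0 ?mulr_gt0 //.
move=> i; rewrite -val_eqE /= inordK ?ltnS ?leq_addr // => iN.
have [h|h] := ltnP n i; first by rewrite nth_default ?mul0r //; apply: leq_trans sp _.
by rewrite mulrC nth_default ?mul0r // (leq_trans sq) //; lia.
Qed.

Lemma lead_pos_subC (c : rat) : lead_pos 1 ('X - c%:P).
Proof. by split; [rewrite size_XsubC|rewrite coefB coefX coefC subr0]. Qed.

Lemma lead_posC (c : rat) : 0 < c -> lead_pos 0 c%:P.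
Proof. by move=> c0; split; rewrite ?coefC // size_polyC_leq1. Qed.

Lemma lead_posXn n : lead_pos n 'X^n.
Proof. by split; rewrite ?size_polyXn ?coefXn ?eqxx. Qed.

Lemma lead_pos_size n p : lead_pos n p -> size p = n.+1.
Proof.
move=> [sp lp]; apply/eqP; rewrite eqn_leq sp; apply: contraTT lp; rewrite -leqNgt => h.
by rewrite nth_default ?ltxx.
Qed.

(** This polynomial is [D(t^m p) / t^(m+1)]. *)
Lemma lead_pos_euler n m (p : {poly rat}) : (0 < m)%N -> lead_pos n p ->
  lead_pos n.+1 (('X - 1) * (m%:R *: p + 'X * p^`())).
Proof.
move=> m0 [sp lp]; rewrite -add1n; apply: lead_posM; first exact: lead_pos_subC.
apply: lead_posD.
- split; first by rewrite (leq_trans (size_scale_leq _ _)).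
  by rewrite coefZ mulr_gt0 // ltr0n.
- have [->|p0] := eqVneq p^`() 0; first by rewrite mulr0 size_poly0.
  rewrite mulrC size_mulX // ltnS (leq_trans _ (_ : (size p).-1 <= _)%N) //; last by lia.
  by rewrite -ltnS (leq_trans (lt_size_deriv _)) ?leqSpred //; apply: contraNneq p0 => ->; rewrite deriv0.
- by rewrite coefXM coef_deriv; case: n {sp} lp => //= n lp; rewrite mulrn_wge0 // ltW.
Qed.

(* Expanding at X = 1 diagonalises the operator (X - 1) d/dX + m. *)
Lemma euler_ode_solve m (q : {poly rat}) : (0 < m)%N ->
  exists2 p : {poly rat}, (size p <= size q)%N & ('X - 1) * p^`() + m%:R *: p = q.
Proof.
move=> m0; pose r := q \Po ('X + 1).
(* The operator multiplies [(X - 1)^i] by [i + m], which is nonzero. *)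
pose s : {poly rat} := \poly_(i < size r) (r`_i / (i + m)%:R).
have X1 : ('X + 1 : {poly rat}) \Po ('X - 1) = 'X.
  by rewrite comp_polyD comp_polyX -[1 in X in _ + X]polyC1 comp_polyC subrK.
exists (s \Po ('X - 1)).
  rewrite size_comp_poly2 ?(size_XsubC 1) //.
  rewrite (leq_trans (size_poly _ _)) // /r size_comp_poly2 //.
  by rewrite -(opprK 1) -polyC1 -polyCN size_XsubC.
rewrite deriv_comp derivB derivX derivC subr0 mulr1.
have -> : q = r \Po ('X - 1) by rewrite /r -comp_polyA X1 comp_polyXr.
rewrite -{1}[('X - 1)](comp_polyX ('X - 1)) -comp_polyM -comp_polyZ -comp_polyD; congr (_ \Po _).
apply/polyP => i; rewrite coefD coefZ coefXM coef_deriv.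
have im : (i + m)%:R != 0 :> rat by rewrite pnatr_eq0; lia.
have si : s`_i * (i + m)%:R = r`_i.
  by rewrite coef_poly; case: ltnP => ir; rewrite ?divfK // mul0r nth_default.
rewrite -si natrD mulrDr; congr (_ + _); last by rewrite mulrC.
by case: i {im si} => [|i] /=; rewrite ?mulr0 // mulr_natr.
Qed.

Lemma euler_ode_lead n m (p q : {poly rat}) : (0 < m)%N -> (size p <= size q)%N ->
  ('X - 1) * p^`() + m%:R *: p = q -> lead_pos n q -> lead_pos n p.
Proof.
move=> m0 spq E [sq lq]; have sp : (size p <= n.+1)%N := leq_trans spq sq.
split=> //; move: lq; rewrite -E mulrBl mul1r !coefD coefN coefZ coefXM !coef_deriv.
rewrite [p`_n.+1]nth_default // mul0rn oppr0 addr0.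
case: n {sp sq} => [|n] /=; first by rewrite add0r pmulr_rgt0 // ltr0n.
by rewrite -[_ *+ n.+1]mulr_natl -mulrDl pmulr_rgt0 // ltr_wpDl ?ltr0n.
Qed.

(** * Induction on m *)

Lemma S_H_step m (e : nat -> {poly rat}) : (2 <= m)%N ->
  (forall a, (2 <= a <= m)%N ->
     euler (S_H a) = fps_eval ('X^a * e a) /\ lead_pos (2 * a - 1) (e a)) ->
  exists p, S_H m.+1 = fps_eval ('X^m * p) /\ lead_pos (2 * m) p.
Proof.
case: m => [|[|n]] // _; set m := n.+2 => H.
have [Em Lm] : euler (S_H m) = fps_eval ('X^m * e m) /\ lead_pos (2 * m - 1) (e m).
  by apply: H; rewrite leqnn.
(* The right side of [S_H_linear] divided by [t^(m+1)]. The two terms with [D S_1] contribute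
   [(t - 1)^2], which joins the [-1] of [- D S_m] to give [t (t - 2)]: this supplies the missing
   factor [t] and the coefficient [X - 2]. *)
pose q := (1 / 2%:R)%:P * ((('X - 1) * (m%:R *: e m + 'X * (e m)^`()) + ('X - 2%:R%:P) * e m)
  + \sum_(a < n) e a.+2 * e (n.+1 - a)%N).
have q_lead : lead_pos (2 * m) q.
  rewrite -[(2 * m)%N]add0n; apply: lead_posM; first exact: lead_posC.
  have -> : (2 * m = (2 * m - 1).+1)%N by lia.
  have L2 (a : 'I_n) : lead_pos (2 * m - 1).+1 (e a.+2 * e (n.+1 - a)%N).
    have -> : ((2 * m - 1).+1 = (2 * a.+2 - 1) + (2 * (n.+1 - a) - 1))%N by have := ltn_ord a; lia.
    by apply: lead_posM; apply: (H _ _).2; have := ltn_ord a; lia.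
  have L1 : lead_pos (2 * m - 1).+1 (('X - 2%:R%:P) * e m).
    by rewrite -add1n; apply: lead_posM => //; apply: lead_pos_subC.
  apply: lead_posD; first apply: lead_posD.
  - exact: lead_pos_euler.
  - by case: L1.
  - by apply: ltW; case: L1.
  - by apply: (leq_trans (size_sum _ _ _)); apply/bigmax_leqP => a _; case: (L2 a).
  - by rewrite coef_sum sumr_ge0 // => a _; apply: ltW; case: (L2 a).
have [p spq Ep] := euler_ode_solve q (ltn0Sn n.+1 : (0 < m)%N).
exists p; split; last exact: euler_ode_lead Ep q_lead.
apply: (@euler_linear_uniq m) => //; rewrite S_H_linear //.
rewrite /m big_ord_recl big_ord_recr -/m /= subn0 euler_S_H1.
have -> : (m - bump 0 n = 1)%N by rewrite /bump /m; lia.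
rewrite euler_S_H1.
rewrite (eq_bigr (fun a : 'I_n => fps_eval ('X^(m.+1) * (e a.+2 * e (n.+1 - a)%N)))) => [|a _]; last first.
  rewrite /bump add1n /m subSS (H a.+2 _).1 ?(H (n.+1 - a)%N _).1; try by (have := ltn_ord a; lia).
  rewrite -fps_evalM; congr fps_eval.
  have -> : 'X^(n.+3) = 'X^(a.+2) * 'X^(n.+1 - a) :> {poly rat}.
    by rewrite -exprD; congr ('X^_); have := ltn_ord a; lia.
  by ring.
rewrite -fps_eval_sum -mulr_sumr Em !euler_fps_eval.
have hc : fps_half = fps_eval (1 / 2%:R)%:P by rewrite fps_evalC.
have tE : t_fps = fps_eval 'X by rewrite fps_evalX.
have mE : m%:R = fps_eval (m%:R)%:P by rewrite fps_evalC rmorph_nat.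
(* Since [1 - z = 1 / t], the operator [(1 - z) D] is [t (t - 1) d/dt]. *)
have zE (u : {poly rat}) : (1 - tree_fps) * fps_eval ('X^2 * ('X - 1) * u) = fps_eval ('X * ('X - 1) * u).
  have tz : (1 - tree_fps) * t_fps = 1 by rewrite mulrBl mul1r tree_mul_t; ring.
  rewrite !(fps_evalM, fps_evalB, fps_evalX, fps_eval1, expr2).
  transitivity ((1 - tree_fps) * t_fps * (t_fps * (t_fps - 1) * fps_eval u)); first by ring.
  by rewrite tz mul1r.
set s := \sum_(a < n) _.
transitivity (fps_eval ('X^(m.+1) * q)).
  transitivity (fps_half * (fps_eval ('X^2 * ('X - 1) * ('X^m * e m)^`()) - fps_eval ('X^m * e m) +
     ((fps_half + fps_half) * ((t_fps - 1) * (t_fps - 1)) * fps_eval ('X^m * e m) +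
      fps_eval ('X^(m.+1) * s)))).
    by ring.
  rewrite fps_halfD mul1r hc tE -fps_eval1 -!(fps_evalM, fps_evalB, fps_evalD); congr fps_eval.
  rewrite /q -/s derivM derivXn -[m%:R *: _]mul_polyC polyC_natr /= !exprS.
  by ring.
(* For [X^m p] the terms without derivative of [p] add up to [m X^(m+1) p], so [X^(m+1)] factors
   out. *)
rewrite zE mE -!(fps_evalM, fps_evalD); congr fps_eval.
rewrite -Ep derivM derivXn /m /= -mul_polyC polyC_natr !exprS.
by ring.
Qed.

Lemma lead_pos_deriv n p : lead_pos n.+1 p -> lead_pos n p^`().
Proof.
move=> hp; have [_ lp] := hp; split; last by rewrite coef_deriv pmulrn_lgt0.
rewrite -ltnS -(lead_pos_size hp) lt_size_deriv // -size_poly_gt0.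
by rewrite (lead_pos_size hp).
Qed.

Definition S2_poly : {poly rat} :=
  (1 / 24%:R)%:P * (('X - 1) * ('X - 1) * (5%:R * 'X - 3%:R)).

Lemma S2_poly_lead : lead_pos 3 S2_poly.
Proof.
rewrite -[3%N]/(0 + (1 + 1 + (0 + 1)))%N.
apply: lead_posM; first by apply: lead_posC; rewrite divr_gt0 ?ltr0n.
apply: lead_posM; first by apply: lead_posM; apply: lead_pos_subC.
have -> : 5%:R * 'X - 3%:R = 5%:R%:P * ('X - (3%:R / 5%:R)%:P) :> {poly rat}.
  by rewrite mulrBr -polyCM polyC_natr -(polyC_natr _ 3); congr (_ - _%:P).
by apply: lead_posM; [apply: lead_posC; rewrite ltr0n|exact: lead_pos_subC].
Qed.

Lemma deriv_S2_poly : S2_poly^`() = (1 / 24%:R)%:P *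
  (2%:R * ('X - 1) * (5%:R * 'X - 3%:R) + 5%:R * (('X - 1) * ('X - 1))).
Proof.
have d1 : ('X - 1 : {poly rat})^`() = 1 by apply: derivXsubC.
have d2 : (5%:R * 'X - 3%:R : {poly rat})^`() = 5%:R.
  by rewrite -!polyC_natr derivB derivM !derivC derivX mul0r mulr1 add0r subr0.
by rewrite /S2_poly derivM derivC mul0r add0r 2!derivM d1 d2; ring.
Qed.

(** This base case is checked directly: [D S_1] has no factor [t], so the general step cannot start
    at [m = 1]. *)
Lemma S_H2E : S_H 2 = fps_eval S2_poly.
Proof.
apply: (@euler_linear_uniq 1) => //; rewrite S_H_linear // big_ord1 /= subn0 euler_S_H1.
have tz : tree_fps * t_fps = t_fps - 1 := tree_mul_t.
pose c := fps_const (1 / 24%:R).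
have h1 : fps_half = c * 12%:R.
  by rewrite fps_natE -rmorphM; congr fps_const; field.
have h2 : fps_half * fps_half = c * 6%:R.
  by rewrite fps_natE -!rmorphM; congr fps_const; field.
have h3 : fps_half * fps_half * fps_half = c * 3%:R.
  by rewrite fps_natE -!rmorphM; congr fps_const; field.
have -> : euler (fps_half * (t_fps - 1) ^+ 2) = t_fps ^+ 2 * (t_fps - 1) ^+ 2.
  rewrite expr2 !eulerM euler_const eulerD eulerN -(rmorph1 fps_const) euler_const rmorph1 euler_t.
  by rewrite -[RHS]mul1r -fps_halfD; ring.
transitivity (fps_half * (t_fps ^+ 2 * (t_fps - 1) ^+ 2) - fps_half * fps_half * (t_fps - 1) ^+ 2
  + fps_half * fps_half * fps_half * (t_fps - 1) ^+ 4); first by ring.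
rewrite h3 h2 h1 euler_fps_eval deriv_S2_poly /S2_poly.
rewrite -!polyC_natr.
rewrite !(fps_evalM, fps_evalB, fps_evalD, fps_evalX, fps_eval1, fps_evalC, expr2) -/c !rmorph_nat.
set Q := RHS.
(* A multiple of [z t - (t - 1) = 0] is added to remove [z], after which the identity is polynomial
   in [t]. *)
have -> : Q = Q + (tree_fps * t_fps - (t_fps - 1)) * (t_fps * (t_fps - 1) * c *
   (2%:R * (t_fps - 1) * (5%:R * t_fps - 3%:R) + 5%:R * ((t_fps - 1) * (t_fps - 1)))).
  by rewrite tz subrr mul0r addr0.
by rewrite /Q; ring.
Qed.

(** The divisibility of [D S_m] by [t^m] is what the induction step consumes. For [m >= 3] the
    degree of [S_m] arises as [(m - 1) + 2 (m - 1)], from [t^(m-1)] and its cofactor. *)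
Lemma S_H_stage m : (2 <= m)%N ->
  (exists e, euler (S_H m) = fps_eval ('X^m * e) /\ lead_pos (2 * m - 1) e) /\
  (exists p, S_H m = fps_eval p /\ lead_pos (3 * m - 3) p).
Proof.
elim/ltn_ind: m => m IH m2.
have [->|m3] := eqVneq m 2.
  split; last by exists S2_poly; split; [exact: S_H2E|exact: S2_poly_lead].
  exists (('X - 1) * S2_poly^`()); split; first by rewrite S_H2E euler_fps_eval mulrA.
  apply: (@lead_posM 1 2); first exact: lead_pos_subC.
  exact: lead_pos_deriv S2_poly_lead.
case: m IH m2 m3 => [//|m] IH m1 m3; have m2 : (2 <= m)%N by move: m1 m3; lia.
have /choice[e eP] : forall a, exists e, (2 <= a <= m)%N ->
    euler (S_H a) = fps_eval ('X^a * e) /\ lead_pos (2 * a - 1) e.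
  move=> a; have [h|_] := boolP (2 <= a <= m)%N; last by exists 0.
  have /andP[a2 am] := h.
  by have [[e ?] _] := IH a am a2; exists e.
have [p [pE pL]] := S_H_step m2 eP.
split; last first.
  exists ('X^m * p); split=> //; have -> : (3 * m.+1 - 3 = m + 2 * m)%N by lia.
  by apply: lead_posM pL; apply: lead_posXn.
exists (('X - 1) * (m%:R *: p + 'X * p^`())); split; last first.
  have -> : (2 * m.+1 - 1 = (2 * m).+1)%N by lia.
  by apply: lead_pos_euler => //; apply: leq_trans m2.
rewrite pE euler_fps_eval; congr fps_eval.
case: m m2 {IH eP pE pL m1 m3} => // m _.
by rewrite derivM derivXn -mul_polyC polyC_natr /= !exprS; ring.
Qed.

(** * Return to the variable w *)

Theorem theorem5p1 :
  (forall m : nat, forall k : nat,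
     fps_xinv m (fps_Dw (fps_xpow m (S_H m.+1))) k =
     - (1 / 2%:R) *
       ( fps_Dw (fps_Dw (S_H m)) k
       + \sum_(a < m.+2) fps_mul (fps_Dw (S_H a)) (fps_Dw (S_H (m.+1 - a)%N)) k
       + fps_Dw (S_H m) k ))
  /\ (forall m : nat, (2 <= m)%N ->
        exists p : {poly rat},
          size p = (3 * m - 3).+1 /\
          (forall k : nat, S_H m k = fps_of_poly p t_fps k) /\
          p.[1] = 0)
  /\ (forall m : nat, S_H m 0%N = 0).
Proof.
split=> [m k|]; last split=> [m m2|]; last exact: S_H0.
  (* Shifting by [m] before and after the derivative replaces the factor [k] by [k + m]. *)
  rewrite /fps_xinv /fps_Dw /fps_xpow leq_addl addnK.
  have := congr1 (fun f : fps => f k) (S_H_series m).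
  rewrite fps_natE fps_constM !fpsDE fps_constM fpsNE fps_sumE /euler => E.
  rewrite natrD mulrDl E mulNr; congr (- (_ * _)).
  (* With [d/dw = - D], the second derivative and the products keep their sign and the first
     derivative changes it. *)
  rewrite mulrN opprK addrAC; congr (_ + _ - _); apply: eq_bigr => a _.
  by apply: eq_bigr => i _; rewrite mulrNN.
have [_ [p [pE pL]]] := S_H_stage m2.
exists p; split; first exact: lead_pos_size.
split=> [k|]; first by rewrite fps_of_polyE pE.
by rewrite -fps_eval_at0 -pE S_H0.
Qed.
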